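(* Let $\mathfrak{g}_n=\mathfrak{gl}(n,\mathbb{C})$ or $\mathfrak{g}_n=\mathfrak{so}(n,\mathbb{C})$, let $d$ be half the dimension of a regular adjoint orbit in $\mathfrak{g}_n$, and let $\mathfrak{a}$ be the Lie algebra of vector fields on $\mathfrak{g}_n$ generated by the Hamiltonian vector fields $\xi_{f_{i,j}}$, $1\le i\le n-1$, $1\le j\le r_i$, where the $f_{i,j}$ are the specific invariant polynomials listed in the context. Then the Lie algebra $\mathfrak{a}$ integrates to an analytic action of $A=\mathbb{C}^d$ on $\mathfrak{g}_n$.
   Context: $\mathfrak{so}(n,\mathbb{C})$ is the Lie algebra of $n\times n$ complex skew-symmetric matrices. For $1\le i\le n$ let $\mathfrak{g}_i=\mathfrak{gl}(i,\mathbb{C})$ (if $\mathfrak{g}_n=\mathfrak{gl}(n,\mathbb{C})$) or $\mathfrak{g}_i=\mathfrak{so}(i,\mathbb{C})$ (if $\mathfrak{g}_n=\mathfrak{so}(n,\mathbb{C})$), embedded in $\mathfrak{g}_n$ as the top left $i\times i$ corner with all other entries zero; $r_i$ is the rank of $\mathfrak{g}_i$ (with $\mathfrak{so}(1)=0$, $r_1=0$ in the orthogonal case). For $x\in\mathfrak{g}_n$, $x_i\in\mathfrak{g}_i$ denotes the top left $i\times i$ submatrix (''cutoff'') of $x$. The polynomials $f_{i,j}$ on $\mathfrak{g}_n$ are: for $\mathfrak{g}_i=\mathfrak{gl}(i)$, $f_{i,j}(x)=\mathrm{tr}(x_i^j)$, $1\le j\le i$; for $\mathfrak{g}_i=\mathfrak{so}(2l)$,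 $f_{i,j}(x)=\mathrm{tr}(x_i^{2j})$ for $1\le j\le l-1$ and $f_{i,l}(x)=\mathrm{Pfaff}(x_i)$ (the Pfaffian); for $\mathfrak{g}_i=\mathfrak{so}(2l+1)$, $f_{i,j}(x)=\mathrm{tr}(x_i^{2j})$ for $1\le j\le l$. Let $\beta(x,y)=\mathrm{tr}(xy)$ be the trace form on $\mathfrak{g}_n$. For a holomorphic function $f$ on $\mathfrak{g}_n$, $\nabla f(x)\in\mathfrak{g}_n$ is defined by $\beta(\nabla f(x),z)=\frac{d}{dt}\big|_{t=0}f(x+tz)$ for all $z\in\mathfrak{g}_n$. The Lie-Poisson bracket is $\{f,g\}(x)=\beta(x,[\nabla f(x),\nabla g(x)])$, and the Hamiltonian vector field of $f$ is $\xi_f(g)=\{f,g\}$; its value at $x$ is the tangent vector $[x,\nabla f(x)]\in T_x(\mathfrak{g}_n)\simeq\mathfrak{g}_n$. The vector fields $\xi_{f_{i,j}}$ pairwise commute. An element $x$ (or its adjoint orbit) is regular if $\dim$ of its centralizer in $\mathfrak{g}_n$ equals the rank of $\mathfrak{g}_n$; one has $d=\sum_{i=1}^{n-1}r_i$. ''$\mathfrak{a}$ integrates to an action of $\mathbb{C}^d$'' means: writing elements of $\mathbb{C}^d$ as $(t_{i,j})_{1\le i\le n-1,\,1\le j\le r_i}$, there is an action of $\mathbb{C}^d$ on $\mathfrak{g}_n$ for which the $(i,j)$-th coordinate subgroup acts by the (global, complex-time) flow of $\xi_{f_{i,j}}$. *)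

(* Defs.v *)
From HB Require Import structures.
From mathcomp Require Import all_boot all_order all_algebra all_fingroup.
From mathcomp Require Import complex finmap.
From mathcomp Require Import all_classical all_reals all_analysis.
From mathcomp Require Import summability.
Set Implicit Arguments.
Unset Strict Implicit.
Unset Printing Implicit Defensive.
Import Order.TTheory GRing.Theory Num.Theory.
Import numFieldNormedType.Exports.
Local Open Scope ring_scope.
Local Open Scope classical_set_scope.

Inductive lie_type := GL | SO.

(* Rank (dimension of a Cartan subalgebra): i for gl(i), l for so(2l) and
   so(2l+1); in particular so(1) has rank 0 and so(2) has rank 1. *)
Definition lie_rank (k : lie_type) (i : nat) : nat :=
  match k with GL => i | SO => i./2 end.

Lemma double_succ_ltn_half n (k : 'I_n./2) : (k.*2.+1 < n)%N.
Proof.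
have : (k.*2.+2 <= n./2.*2)%N by rewrite -doubleS leq_double.
by move/leq_trans; apply; rewrite -[leqRHS]odd_double_half leq_addl.
Qed.

Lemma double_ltn_half n (k : 'I_n./2) : (k.*2 < n)%N.
Proof. exact: ltn_trans (ltnSn _) (double_succ_ltn_half k). Qed.

Lemma level_leq n (i : 'I_n.-1) : (i.+1 <= n)%N.
Proof. exact: leq_trans (ltn_ord i) (leq_pred n). Qed.

(* Index set of the f_{i,j} with 1 <= i <= n-1 and 1 <= j <= r_i: the pair
   (i0, j0) of 0-based ordinals stands for (i, j) = (i0 + 1, j0 + 1). *)
Definition gz_index (k : lie_type) (n : nat) : finType :=
  {i : 'I_n.-1 & 'I_(lie_rank k i.+1)}.

(* The scalar field C is meant to be the field R[i] of complex numbers, for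
   which [is_derive] is complex differentiation. *)
Section GelfandZeitlin.
Variable C : numFieldType.

Section LieAlgebra.
Variables (k : lie_type) (n : nat).
Implicit Types x y z : 'M[C]_n.

Definition lie_alg : {vspace 'M[C]_n} :=
  match k with
  | GL => fullv
  | SO => lker (linfun (@trmx C n n \+ idfun))
  end.

Definition bracket x y : 'M[C]_n := x *m y - y *m x.

Definition ad x : 'End('M[C]_n) := linfun (mulmx x \- mulmxr x).

Definition centralizer x : {vspace 'M[C]_n} := (lie_alg :&: lker (ad x))%VS.

Definition regular x : Prop := \dim (centralizer x) = lie_rank k n.

(* The tangent space at x of the adjoint orbit of x is [x, g]. *)
Definition orbit_dim x : nat := \dim (ad x @: lie_alg)%VS.

Definition is_gradient (f : 'M[C]_n -> C) x (v : 'M[C]_n) : Prop :=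
  v \in lie_alg /\
  forall z, z \in lie_alg ->
    is_derive (0 : C) (1 : C) (fun t : C => f (x + t *: z)) (\tr (v *m z)).

(* The trace form is nondegenerate on g, so there is at most one gradient at a
   given point (the default value 0 is used only when there is none). *)
Definition gradient (f : 'M[C]_n -> C) x : 'M[C]_n :=
  xget 0 [set v | is_gradient f x v].

Definition hamiltonian_field (f : 'M[C]_n -> C) x : 'M[C]_n :=
  bracket x (gradient f x).

End LieAlgebra.

Lemma mem_lie_alg_SO n (x : 'M[C]_n) : (x \in lie_alg SO n) = (x^T == - x).
Proof. by rewrite memv_ker lfunE /= addr_eq0. Qed.

Lemma adE n (x y : 'M[C]_n) : ad x y = bracket x y.
Proof. by rewrite lfunE. Qed.

Lemma mem_centralizer k n (x y : 'M[C]_n) :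
  (y \in centralizer k x) = (y \in lie_alg k n) && (bracket x y == 0).
Proof. by rewrite memv_cap; congr (_ && _); rewrite memv_ker adE. Qed.

(* Pf(x) = (2^l l!)^-1 sum_s sgn(s) prod_(k < l) x_{s(2k), s(2k+1)}, l = n/2
   (0-based indices); meaningful for n even and x skew-symmetric. *)
Definition pfaffian n (x : 'M[C]_n) : C :=
  ((2 ^ n./2 * (n./2)`!)%:R)^-1 *
  \sum_(s : 'S_n) (-1) ^+ s *
     \prod_(k : 'I_n./2) x (s (Ordinal (double_ltn_half k)))
                           (s (Ordinal (double_succ_ltn_half k))).

(* The basic invariants of g_i; here j is 1-based. *)
Definition invariant (k : lie_type) (i j : nat) (x : 'M[C]_i) : C :=
  match k with
  | GL => \tr (x ^+ j)
  | SO => if ~~ odd i && (j == i./2) then pfaffian x else \tr (x ^+ (2 * j))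
  end.

Definition cutoff n i (le_in : (i <= n)%N) (x : 'M[C]_n) : 'M[C]_i :=
  mxsub (widen_ord le_in) (widen_ord le_in) x.

Section Action.
Variables (k : lie_type) (n : nat).

Definition gz_fun (p : gz_index k n) (x : 'M[C]_n) : C :=
  invariant k (tagged p).+1 (cutoff (level_leq (tag p)) x).

(* F is analytic on the subset S of C^I: near each point a of S, F agrees on S
   with an (unconditionally) convergent power series centred at a.  When S is a
   linear subspace, this is analyticity in linear coordinates on S. *)
Definition analytic_on (I : finType) (S : set {ffun I -> C})
    (F : {ffun I -> C} -> C) : Prop :=
  forall a, S a ->
  exists (c : {ffun I -> nat} -> C) (r : C), 0 < r /\
    forall h : {ffun I -> C}, (forall e, `|h e| < r) -> S (a + h) ->
      partial_sum (fun m : {ffun I -> nat} => c m * \prod_e h e ^+ m e) @ totally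
        --> F (a + h).

Section AbstractAction.
Variables (T : finType) (act : {ffun T -> C} -> 'M[C]_n -> 'M[C]_n).

Definition is_additive_action : Prop :=
  [/\ forall t x, x \in lie_alg k n -> act t x \in lie_alg k n,
      forall x, x \in lie_alg k n -> act 0 x = x
    & forall s t x, x \in lie_alg k n -> act (s + t) x = act s (act t x)].

(* Coordinates on C^T * M_n(C): [inl] for the group, [inr] for the entries. *)
Definition group_part (u : {ffun T + 'I_n * 'I_n -> C}) : {ffun T -> C} :=
  [ffun p => u (inl p)].

Definition matrix_part (u : {ffun T + 'I_n * 'I_n -> C}) : 'M[C]_n :=
  \matrix_(a, b) u (inr (a, b)).

Definition analytic_action : Prop :=
  forall a b : 'I_n,
    analytic_on [set u | matrix_part u \in lie_alg k n]
      (fun u => act (group_part u) (matrix_part u) a b).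

Definition coord_subgroup (p : T) (s : C) : {ffun T -> C} :=
  [ffun q => if q == p then s else 0].

(* With [act 0 x = x], s |-> act (coord_subgroup p s) x is the integral curve
   through x, defined for all complex times, of the vector field [xi p]. *)
Definition acts_by_flows (xi : T -> 'M[C]_n -> 'M[C]_n) : Prop :=
  forall p x, x \in lie_alg k n ->
  forall s : C,
    is_derive s (1 : C) (fun s' : C => act (coord_subgroup p s') x)
      (xi p (act (coord_subgroup p s) x)).

End AbstractAction.

Definition gz_field (p : gz_index k n) : 'M[C]_n -> 'M[C]_n :=
  hamiltonian_field k (gz_fun p).

End Action.
End GelfandZeitlin.

(* Main.v *)
Require Import Defs.
From HB Require Import structures.
From mathcomp Require Import all_boot all_order all_algebra all_fingroup.
From mathcomp Require Import complex finmap.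
From mathcomp Require Import all_classical all_reals all_analysis.
From mathcomp Require Import summability.
From mathcomp Require Import zify ring.
Import Order.TTheory GRing.Theory Num.Theory.
Import numFieldNormedType.Exports.
Local Open Scope ring_scope.
Local Open Scope classical_set_scope.
Set Implicit Arguments.
Unset Strict Implicit.
Unset Printing Implicit Defensive.

(** The flow of the Hamiltonian field of f = f_{i,j} can be written down.  As f
    only sees the cutoff x_i and is an invariant of g_i, its gradient v(x) is
    the image in g_n of a matrix of g_i that commutes with x_i
    ([inv_gradient_comm]).  Along x' = [x, v(x)] the cutoff x_i is therefore
    constant, hence so is v(x), and the integral curve is
      exp(-t v(x)) x exp(t v(x)),
    which exists for every complex time t ([gz_flow], [is_derive_gz_flow]).

    Two such flows commute.  Let i <= i', let g = exp(-t v(x)) be the conjugator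
    of the flow at level i and h = exp(-s v'(x)) the one at level i'.  The matrix
    g is in the group of g_i, inside the group of g_i', and gradients of
    invariants are equivariant, so that v'(g x g^-1) = g v'(x) g^-1
    ([gz_gradient_flow_above]); and h commutes with x_i', so that the flow at
    level i' fixes x_i' and a fortiori x_i and v(x) ([gz_gradient_flow_below]).
    In both orders the composite sends x to (g h) x (g h)^-1.  Composing all the
    flows thus gives an action of the additive group of C^d.

    Analyticity would be delicate for an iterated composition, but if the flows
    at the higher levels are applied first, the inner ones leave the gradient
    used by the outer one unchanged, so that every exponent can be evaluated at
    the initial point ([compose_flows_closed_form]).  The action is then a
    product of exponentials of matrices that are polynomial in (t, x), and no
    exponential is nested in another one.  The terms of the exponential series
    of a polynomial matrix are polynomials whose coefficients, in absolute
    value, have a sum dominated by the terms of a convergent real exponential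
    series; products preserve such expansions, and they can be rearranged into
    a power series ([summable_expansion_partial_sum]).

    For the Pfaffian, Pf(g x g^T) = det(g) Pf(x) ([pfaffian_congruence]) yields
    the invariance under exp(so), hence the equivariance of the gradient, and,
    by differentiation at the identity, the fact that the gradient at x commutes
    with x ([pf_gradient_comm]).

    The number of flows comes from dim g_n - rank g_n = 2 (r_1 + ... + r_{n-1}),
    the left-hand side being the dimension of a regular orbit. *)

(** * Dimension of a regular orbit *)

Section Dimension.
Variable C : numFieldType.

(** Allows ranks of matrices whose rows are flattened matrices to be used for
    subspaces of the space of matrices, in particular for [rank_skew]. *)
Lemma dim_rowspace (F : fieldType) m n1 n2 (A : 'M[F]_(m, n1 * n2))
    (U : {vspace 'M[F]_(n1, n2)}) :
  (forall v, (v \in U) = (mxvec v <= A)%MS) -> \dim U = \rank A.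
Proof.
move=> UA; pose X := [tuple vec_mx (row i (row_base A)) | i < \rank A].
have sumX (u : 'rV_(\rank A)) :
    \sum_i u 0 i *: X`_i = vec_mx (u *m row_base A).
  rewrite mulmx_sum_row linear_sum; apply: eq_bigr => i _.
  by rewrite linearZ -tnth_nth tnth_mktuple.
have freeX : free X.
  apply/freeP => c cX i; pose u := \row_j c j.
  have : u *m row_base A = 0.
    apply: (can_inj vec_mxK); rewrite -sumX linear0 -[RHS]cX.
    by apply: eq_bigr => j _; rewrite mxE.
  move=> /eqP; rewrite mulmx_free_eq0 ?row_base_free// => /eqP/rowP/(_ i).
  by rewrite !mxE.
suff -> : U = <<X>>%VS by rewrite (eqP freeX) size_tuple.
apply/vspaceP => v; rewrite UA -(eq_row_base A).
apply/idP/idP => [/submxP[u vu]|/coord_span ->].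
  rewrite -[v]mxvecK vu -sumX; apply: rpred_sum => i _.
  by rewrite rpredZ// memv_span// mem_nth// size_tuple.
rewrite (eq_bigr (fun i => (\row_j coord X j v) 0 i *: X`_i)).
  by rewrite sumX vec_mxK submxMl.
by move=> i _; rewrite mxE.
Qed.

Lemma dim_lie_alg_SO n : \dim (lie_alg C SO n) = (n * n.-1)./2.
Proof.
rewrite -(@rank_skew C n); apply: dim_rowspace => v.
rewrite mem_lie_alg_SO; apply/eqP/skewP; by rewrite mxvecK.
Qed.

Lemma dim_lie_alg k n :
  \dim (lie_alg C k n) = match k with GL => n * n | SO => (n * n.-1)./2 end.
Proof.
case: k; last exact: dim_lie_alg_SO.
by rewrite dimvf /dim.
Qed.

Lemma orbit_dim_regular k n (x : 'M[C]_n) : regular k x ->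
  (orbit_dim k x + lie_rank k n = \dim (lie_alg C k n))%N.
Proof.
by move=> xreg; rewrite -xreg addnC limg_ker_dim.
Qed.

Lemma card_gz_index k n : #|gz_index k n| = \sum_(i < n.-1) lie_rank k i.+1.
Proof.
rewrite /gz_index card_tagged sumnE big_map big_enum /=.
by apply: eq_bigr => i _; rewrite card_ord.
Qed.

(** This is dim g_n = r_n + 2 (r_1 + ... + r_(n-1)); for so(n), passing from n to
    n + 1 adds n to the dimension, and r_n + r_(n+1) = n. *)
Lemma sum_lie_rank k n : (0 < n)%N ->
  ((\sum_(i < n.-1) lie_rank k i.+1).*2 + lie_rank k n)%N =
  match k with GL => n * n | SO => (n * n.-1)./2 end.
Proof.
case: n => // n _; elim: n => [|n IH]; first by rewrite big_ord0; case: k.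
rewrite -[n.+2.-1]/n.+1 big_ord_recr /= in IH *.
case: k IH => /= IH; first by nia.
have odd_h m : m = (odd m + m./2.*2)%N by rewrite odd_double_half.
have h1 : (((n.+1 * n)./2).*2 = n.+1 * n)%N.
  by rewrite -[RHS]odd_double_half oddM /= andNb.
have h2 : (((n.+2 * n.+1)./2).*2 = n.+2 * n.+1)%N.
  by rewrite -[RHS]odd_double_half oddM /= negbK; case: (odd n).
have := odd_h n.
have := uphalf_half n.
case: (odd n) => /=; rewrite -!muln2 in h1 h2 IH *; nia.
Qed.

Lemma card_gz_index_half_orbit k n (x : 'M[C]_n) d : (0 < n)%N ->
  regular k x -> orbit_dim k x = d.*2 -> #|gz_index k n| = d.
Proof.
move=> n_gt0 xreg xd; apply: double_inj; apply/eqP.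
rewrite -(eqn_add2r (lie_rank k n)) card_gz_index sum_lie_rank//.
by rewrite -dim_lie_alg -(orbit_dim_regular xreg) xd.
Qed.

End Dimension.

(** * Limits in the complex field and entrywise limits of matrices *)

Section ComplexLimits.
Variable R : realType.
Local Notation C := (R[i] : numFieldType).
Implicit Types (u v : nat -> C) (b : nat -> R).

(** The modulus as a real number: the norm of R[i] takes its values in R[i],
    while domination arguments need real series. *)
Definition cabs (z : C) : R := complex.Re `|z|.

Lemma cabsE z : (cabs z)%:C%C = `|z|.
Proof. by rewrite /cabs RRe_real// normr_real. Qed.

Lemma cabs_ge0 z : 0 <= cabs z.
Proof. by rewrite -ler0c cabsE. Qed.

Lemma cvg_real_complex (T : Type) (F : set_system T) {FF : Filter F}
    (f : T -> R) (l : R) :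
  f @ F --> l -> (fun x => (f x)%:C%C : C) @ F --> ((l%:C%C : R[i]) : C).
Proof.
move=> /cvgrPdist_lt fl; apply/cvgrPdist_lt => e e0.
have er : (complex.Re e)%:C%C = e by rewrite RRe_real// gtr0_real.
have re0 : 0 < complex.Re e by rewrite -ltcR er.
apply: filterS (fl _ re0) => x.
rewrite -rmorphB normc_def /= expr0n addr0 sqrtr_sqr -[in X in _ -> _ < X]er.
by rewrite ltcR.
Qed.

Lemma norm_lim_le u l (B : R) : u @ \oo --> l ->
  (\forall N \near \oo, `|u N| <= B%:C%C) -> `|l| <= B%:C%C.
Proof.
move=> ul uB; rewrite -cabsE lecR; apply/ler_addgt0Pr => e e0.
have [N [uN lN]] : exists N, `|u N| <= B%:C%C /\ `|l - u N| < e%:C%C.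
  have e0' : 0 < e%:C%C :> C by rewrite ltcR.
  move/cvgrPdist_lt : ul => /(_ _ e0') ul.
  have [N [? ?]] := filter_ex (filterI uB ul); by exists N.
rewrite -lecR rmorphD /= cabsE -[l](subrK (u N)) addrC.
by rewrite (le_trans (ler_normD _ _))// lerD// ltW.
Qed.

Lemma is_cvg_complex_series u b : (forall k, `|u k| <= (b k)%:C%C) ->
  cvgn (series b) -> cvgn (series u).
Proof.
move=> ub cvb.
have b0 k : 0 <= b k by rewrite -ler0c (le_trans _ (ub k)).
have rcv (f : nat -> R) : (forall k, `|f k| <= b k) -> cvgn (series f).
  move=> fb; apply: normed_cvg; apply: series_le_cvg cvb => // k.
  exact: normr_ge0.
have cvRe : cvgn (series (fun k => complex.Re (u k))).
  by apply: rcv => k; rewrite -lecR (le_trans (normc_ge_Re _)).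
have cvIm : cvgn (series (fun k => complex.Im (u k))).
  apply: rcv => k; rewrite -normrN -ReiNIm -lecR.
  by rewrite (le_trans (normc_ge_Re _))// normrM normCi mulr1.
have -> : series u = (fun N => (series (fun k => complex.Re (u k)) N)%:C%C
     + 'i%C * (series (fun k => complex.Im (u k)) N)%:C%C).
  apply/funext => N; rewrite /series /= !rmorph_sum mulr_sumr -big_split /=.
  by apply: eq_bigr => k _; rewrite -complexE.
apply/cvg_ex; exists ((limn (series (fun k => complex.Re (u k))))%:C%C +
  'i%C * (limn (series (fun k => complex.Im (u k))))%:C%C).
apply: cvgD; first exact: cvg_real_complex.
by apply: cvgM; [exact: cvg_cst|exact: cvg_real_complex].
Qed.

Lemma cvg_to0 u b : (forall k, `|u k| <= (b k)%:C%C) -> b @ \oo --> (0 : R) ->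
  u @ \oo --> (0 : C).
Proof.
move=> ub /(@cvg_real_complex _ _ _ b 0)/cvgrPdist_lt b0; apply/cvgrPdist_lt => e e0.
apply: filterS (b0 _ e0) => k; rewrite !sub0r !normrN; apply: le_lt_trans.
by rewrite (le_trans (ub k))// real_ler_norm// complex_real.
Qed.

End ComplexLimits.

Section MatrixLimits.
Variable C : numFieldType.

Definition mxcvg m n (u : nat -> 'M[C]_(m, n)) (l : 'M[C]_(m, n)) :=
  forall a b, (fun N => u N a b) @ \oo --> l a b.

Lemma mxcvg_unique m n (u : nat -> 'M[C]_(m, n)) l l' :
  mxcvg u l -> mxcvg u l' -> l = l'.
Proof.
move=> ul ul'; apply/matrixP => a b.
exact: (cvg_unique (@norm_hausdorff C C) (ul a b) (ul' a b)).
Qed.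

Lemma mxcvg_cst m n (A : 'M[C]_(m, n)) : mxcvg (fun=> A) A.
Proof. by move=> a b; exact: cvg_cst. Qed.

Lemma mxcvgB m n (u v : nat -> 'M[C]_(m, n)) A B :
  mxcvg u A -> mxcvg v B -> mxcvg (fun N => u N - v N) (A - B).
Proof.
move=> uA vB a b; rewrite !mxE; under eq_fun do rewrite !mxE.
by apply: cvgB; [exact: uA|exact: vB].
Qed.

Lemma mxcvgM m n p (u : nat -> 'M[C]_(m, n)) (v : nat -> 'M[C]_(n, p)) A B :
  mxcvg u A -> mxcvg v B -> mxcvg (fun N => u N *m v N) (A *m B).
Proof.
move=> uA vB a b; rewrite mxE.
under eq_fun do rewrite mxE.
have -> : (fun N => \sum_j u N a j * v N j b) =
    \sum_j (fun N => u N a j * v N j b) by apply/funext => y; rewrite fct_sumE.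
elim/big_ind2 : _ => [|f x g y fx gy|j _]; [exact: cvg_cst|exact: cvgD|].
by apply: cvgM.
Qed.

Lemma cvg_mx (T : Type) (F : set_system T) {FF : Filter F} m n
    (f : T -> 'M[C]_(m, n)) (l : 'M[C]_(m, n)) :
  (forall a b, (fun x => f x a b) @ F --> l a b) -> f @ F --> l.
Proof.
move=> fl; apply/cvg_ballP => e e0.
have near_entries : \forall x \near F, forall a b, ball (l a b) e (f x a b).
  apply: filter_forall => a; apply: filter_forall => b.
  by have /cvg_ballP := fl a b; apply.
by apply: filterS near_entries => x xe; split.
Qed.

Lemma is_derive_mx (V : normedModType C) m n (f : V -> 'M[C]_(m, n)) x v
    (df : 'M[C]_(m, n)) :
  (forall a b, is_derive x v (fun y => f y a b) (df a b)) -> is_derive x v f df.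
Proof.
move=> fdf; have h : (fun h => h^-1 *: ((f \o shift x) (h *: v) - f x)) @ 0^' --> df.
  apply: cvg_mx => a b; have [fd <-] := fdf a b.
  by under eq_fun do rewrite !mxE.
split; first by apply/cvg_ex; exists df.
by apply: cvg_lim => //.
Qed.

Lemma is_derive_bigsum (V W : normedModType C) (I : Type) (s : seq I) (P : pred I)
    (h : I -> V -> W) (dh : I -> W) x v :
  (forall i, P i -> is_derive x v (h i) (dh i)) ->
  is_derive x v (fun y => \sum_(i <- s | P i) h i y) (\sum_(i <- s | P i) dh i).
Proof.
move=> hdh.
have -> : (fun y => \sum_(i <- s | P i) h i y) = \sum_(i <- s | P i) h i.
  by apply/funext => y; rewrite fct_sumE.
elim/big_ind2 : _ => [|f a g b fa gb|//]; [exact: is_derive_cst|exact: is_deriveD].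
Qed.

Lemma is_derive_mulmx (V : normedModType C) m n p (f : V -> 'M[C]_(m, n))
    (g : V -> 'M[C]_(n, p)) (df : 'M[C]_(m, n))
    (dg : 'M[C]_(n, p)) x v :
  (forall a b, is_derive x v (fun y => f y a b) (df a b)) ->
  (forall a b, is_derive x v (fun y => g y a b) (dg a b)) ->
  forall a b, is_derive x v (fun y => (f y *m g y) a b)
    ((f x *m dg + df *m g x) a b).
Proof.
move=> fdf gdg a b.
under eq_fun do rewrite mxE.
rewrite !mxE -big_split /=; apply: is_derive_bigsum => j _.
apply: is_derive_eq (is_deriveM (fdf a j) (gdg j b)) _.
by rewrite /GRing.scale /= [g x j b * _]mulrC.
Qed.

Lemma is_derive_entry_cst (V : normedModType C) m n (A : 'M[C]_(m, n)) (x v : V) a b :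
  is_derive x v (fun=> A a b) ((0 : 'M[C]_(m, n)) a b).
Proof. by rewrite mxE; exact: is_derive_cst. Qed.

End MatrixLimits.
Arguments mxcvg_cst {C m n} A.

(** * The matrix exponential *)
Definition expm_part (C : numFieldType) n (w : 'M[C]_n) (N : nat) : 'M[C]_n :=
  \sum_(k < N) (k`!%:R)^-1 *: w ^+ k.

HB.lock Definition expm (C : numFieldType) n (w : 'M[C]_n) : 'M[C]_n :=
  \matrix_(a, b) lim ((fun N => expm_part w N a b) @ \oo).

Section MatrixExponential.
Variable R : realType.
Local Notation C := (R[i] : numFieldType).

Definition mxnorm1 m n (w : 'M[C]_(m, n)) : R := \sum_a \sum_b cabs (w a b).

Lemma mxnorm1_ge0 m n (w : 'M[C]_(m, n)) : 0 <= mxnorm1 w.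
Proof. by do 2!(apply: sumr_ge0 => ? _); apply: cabs_ge0. Qed.

Lemma row_norm1_le m n (w : 'M[C]_(m, n)) a : \sum_b cabs (w a b) <= mxnorm1 w.
Proof.
rewrite /mxnorm1 (bigD1 a)//= lerDl.
by do 2!(apply: sumr_ge0 => ? _); apply: cabs_ge0.
Qed.

Lemma norm_mxpow_le n (w : 'M[C]_n) k a b : `|(w ^+ k) a b| <= (mxnorm1 w ^+ k)%:C%C.
Proof.
elim: k a b => [|k IH] a b.
  by rewrite !expr0 mxE; case: eqP; rewrite ?normr1 ?normr0// ler0c.
rewrite exprS mxE exprS rmorphM /=.
have := row_norm1_le w a; rewrite -lecR rmorph_sum /= => wa.
apply: le_trans (ler_norm_sum _ _ _) _.
apply: le_trans (ler_wpM2r _ wa); last by rewrite ler0c exprn_ge0// mxnorm1_ge0.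
rewrite mulr_suml; apply: ler_sum => j _.
by rewrite normrM cabsE ler_wpM2l.
Qed.

Lemma norm_expm_term_le n (w : 'M[C]_n) k a b :
  `|(k`!%:R)^-1 * (w ^+ k) a b| <= (exp_coeff (mxnorm1 w) k)%:C%C.
Proof.
rewrite /exp_coeff /= rmorphM fmorphV /= rmorph_nat mulrC normrM.
rewrite [X in _ * X]ger0_norm ?invr_ge0// ler_wpM2r ?invr_ge0//.
exact: norm_mxpow_le.
Qed.

Lemma expm_partE n (w : 'M[C]_n) a b :
  (fun N => expm_part w N a b) =
  series (fun k => (k`!%:R)^-1 * (w ^+ k) a b : C).
Proof.
apply/funext => N; rewrite /series /= /expm_part summxE big_mkord.
by apply: eq_bigr => k _; rewrite mxE.
Qed.

Lemma cvg_expm n (w : 'M[C]_n) : mxcvg (expm_part w) (expm w).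
Proof.
move=> a b; rewrite unlock mxE expm_partE.
apply: is_cvg_complex_series (is_cvg_series_exp_coeff (mxnorm1 w)) => k.
exact: norm_expm_term_le.
Qed.

Arguments cvg_expm {n} w.

Lemma mxpow_intertwine m n (A : 'M[C]_(m, n)) (w : 'M[C]_n) (w' : 'M[C]_m) k :
  A *m w = w' *m A -> A *m w ^+ k = w' ^+ k *m A.
Proof.
move=> Aw; elim: k => [|k IH]; first by rewrite !expr0 mulmx1 mul1mx.
by rewrite !exprS -!mulmxE mulmxA Aw -!mulmxA IH.
Qed.

(** Equivariance under conjugation, commutation and compatibility with block
    embeddings are all instances of this. *)
Lemma expm_intertwine m n (A : 'M[C]_(m, n)) (w : 'M[C]_n) (w' : 'M[C]_m) :
  A *m w = w' *m A -> A *m expm w = expm w' *m A.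
Proof.
move=> Aw.
have AwN := mxcvgM (mxcvg_cst A) (cvg_expm w).
apply: (mxcvg_unique AwN); rewrite (_ : (fun N => _) = fun N => expm_part w' N *m A).
  exact: mxcvgM (cvg_expm w') (mxcvg_cst A).
apply/funext => N; rewrite /expm_part mulmx_sumr mulmx_suml.
by apply: eq_bigr => k _; rewrite -scalemxAr -scalemxAl (mxpow_intertwine _ Aw).
Qed.

Lemma expm_comm n (A w : 'M[C]_n) : A *m w = w *m A -> A *m expm w = expm w *m A.
Proof. exact: expm_intertwine. Qed.

Lemma trmx_expn n (w : 'M[C]_n) k : (w ^+ k)^T = w^T ^+ k.
Proof.
elim: k => [|k IH]; first by rewrite !expr0 trmx1.
by rewrite exprS exprSr -!mulmxE trmx_mul IH.
Qed.

Lemma trmx_expm n (w : 'M[C]_n) : (expm w)^T = expm w^T.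
Proof.
have partT N : expm_part w^T N = (expm_part w N)^T.
  by rewrite /expm_part linear_sum; apply: eq_bigr => k _; rewrite linearZ /= trmx_expn.
apply: mxcvg_unique (cvg_expm w^T) => a b; rewrite mxE.
under eq_fun do rewrite partT mxE.
exact: cvg_expm.
Qed.

Lemma expm0 n : expm (0 : 'M[C]_n) = 1%:M.
Proof.
apply: mxcvg_unique (cvg_expm 0) _ => a b.
apply: cvg_near_cst; exists 1%N => // -[//|N] _.
rewrite /expm_part big_ord_recl /= fact0 invr1 scale1r expr0.
rewrite big1 ?addr0// => k _; rewrite /bump /= add1n exprS -mulmxE mul0mx.
by rewrite scaler0.
Qed.

Definition exp_poly (F : numFieldType) (N : nat) (s : F) : {poly F} :=
  \poly_(j < N) (s ^+ j / j`!%:R).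

Lemma horner_exp_poly (N : nat) (s x : R) :
  (exp_poly N s).[x] = series (exp_coeff (s * x)) N.
Proof.
rewrite horner_poly /series /= big_mkord; apply: eq_bigr => j _.
by rewrite /exp_coeff /= exprMn mulrAC.
Qed.

Lemma expm_part_horner n (w : 'M[C]_n.+1) s N :
  expm_part (s *: w) N = horner_mx w (exp_poly N s).
Proof.
rewrite /exp_poly poly_def rmorph_sum /=; apply: eq_bigr => k _.
rewrite linearZ /= rmorphXn /= horner_mx_X exprZn scalerA mulrC.
by [].
Qed.

Lemma coef_exp_poly_low (F : numFieldType) N (s t : F) m : (m < N)%N ->
  (exp_poly N s * exp_poly N t)`_m = (exp_poly N (s + t))`_m.
Proof.
move=> mN; rewrite coefM coef_poly mN exprDn_comm; last exact: mulrC.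
rewrite mulr_suml [LHS](reindex_inj rev_ord_inj) /=; apply: eq_bigr => j _.
have jm : (j <= m)%N by rewrite -ltnS.
rewrite subSS subKn// !coef_poly (leq_ltn_trans _ mN) ?leq_subr//.
rewrite (leq_ltn_trans jm mN) -(bin_fact jm) !natrM.
rewrite -mulr_natr.
have : 'C(m, j)%:R != 0 :> F by rewrite pnatr_eq0 -lt0n bin_gt0.
have : j`!%:R != 0 :> F by rewrite pnatr_eq0 -lt0n fact_gt0.
have : (m - j)`!%:R != 0 :> F by rewrite pnatr_eq0 -lt0n fact_gt0.
by move=> h1 h2 h3; field; rewrite h1 h2 h3.
Qed.

Definition exp_defect (F : numFieldType) N (s t : F) : {poly F} :=
  exp_poly N s * exp_poly N t - exp_poly N (s + t).

(** By the binomial formula the truncations only fail to multiply in degree at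
    least N, where the coefficients are sums of products s^j t^l / (j! l!), to
    which the triangle inequality applies. *)
Lemma coef_exp_defect_le N (s t : C) m :
  `|(exp_defect N s t)`_m| <= ((exp_defect N (cabs s) (cabs t))`_m)%:C%C.
Proof.
rewrite /exp_defect !coefB.
have [mN|Nm] := ltnP m N.
  by rewrite !coef_exp_poly_low// !subrr normr0.
rewrite !(coef_poly _ _ m) ltnNge Nm /= !subr0 !coefM rmorph_sum /=.
apply: le_trans (ler_norm_sum _ _ _) _; apply: ler_sum => j _.
rewrite normrM rmorphM /= !coef_poly.
have cf (z : C) k : `|if (k < N)%N then z ^+ k / k`!%:R else 0| =
    (if (k < N)%N then cabs z ^+ k / k`!%:R else 0)%:C%C.
  case: ifP => _; last by rewrite normr0.
  rewrite rmorphM fmorphV rmorph_nat rmorphXn /= cabsE normrM normrX normfV.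
  by rewrite normr_nat.
by rewrite !cf.
Qed.

Lemma size_exp_defect (F : numFieldType) N (s t : F) :
  (size (exp_defect N s t) <= N + N)%N.
Proof.
rewrite (leq_trans (size_polyD _ _))// size_polyN geq_max; apply/andP; split.
  rewrite (leq_trans (size_polyMleq _ _))// (leq_trans (leq_pred _))//.
  by rewrite leq_add// size_poly.
by rewrite (leq_trans (size_poly _ _))// leq_addr.
Qed.

(** Entries of w^m are bounded by the m-th power of the norm of w, so a majorant
    of p coefficient by coefficient yields a majorant of p(w). *)
Lemma horner_mx_norm_le n (w : 'M[C]_n.+1) (p : {poly C}) (q : {poly R}) K a b :
  (size p <= K)%N -> (size q <= K)%N ->
  (forall m, `|p`_m| <= (q`_m)%:C%C) ->
  `|horner_mx w p a b| <= (q.[mxnorm1 w])%:C%C.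
Proof.
move=> sp sq pq.
have -> : horner_mx w p = \sum_(m < K) p`_m *: w ^+ m.
  rewrite -{1}(coefK p) poly_def rmorph_sum /=.
  rewrite (big_ord_widen _ (fun m => horner_mx w (p`_m *: 'X^m)) sp).
  rewrite big_mkcond /=; apply: eq_bigr => m _.
  case: ltnP => pm; last by rewrite nth_default// scale0r.
  by rewrite linearZ /= rmorphXn /= horner_mx_X.
rewrite (horner_coef_wide _ sq) rmorph_sum summxE.
apply: le_trans (ler_norm_sum _ _ _) _; apply: ler_sum => m _.
by rewrite mxE normrM rmorphM /= ler_pM// norm_mxpow_le.
Qed.

(** The defect of the truncations at w is dominated by the defect of the real
    truncated exponentials at the norm of w, which tends to 0 because the real
    exponential is additive. *)
Lemma expmD n (w : 'M[C]_n) s t : expm ((s + t) *: w) = expm (s *: w) *m expm (t *: w).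
Proof.
(* polynomials are evaluated in a nontrivial matrix ring *)
case: n w => [|n] w; first by rewrite [LHS]thinmx0 [RHS]thinmx0.
apply: mxcvg_unique (mxcvgM (cvg_expm (s *: w)) (cvg_expm (t *: w))) => a b.
pose d N := horner_mx w (exp_defect N s t) a b.
have -> : (fun N => (expm_part (s *: w) N *m expm_part (t *: w) N) a b) =
    d + (fun N => expm_part ((s + t) *: w) N a b).
  apply/funext => N; transitivity (d N + expm_part ((s + t) *: w) N a b) => //.
  rewrite /d /exp_defect rmorphB rmorphM /= -!expm_part_horner -mulmxE.
  by rewrite [in RHS]mxE [in X in _ = _ + X + _]mxE subrK.
rewrite -[X in _ --> X]add0r; apply: cvgD; last exact: cvg_expm.
apply: (@cvg_to0 _ _ (fun N => (exp_defect N (cabs s) (cabs t)).[mxnorm1 w])).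
  move=> N; apply: (@horner_mx_norm_le _ _ _ _ (N + N)); rewrite ?size_exp_defect//.
  by move=> m; exact: coef_exp_defect_le.
under eq_fun do rewrite /exp_defect hornerD hornerN hornerM !horner_exp_poly.
have cvE (x : R) : series (exp_coeff x) @ \oo --> expR x.
  exact: is_cvg_series_exp_coeff.
rewrite -(subrr (expR ((cabs s + cabs t) * mxnorm1 w))).
by apply: cvgB; [rewrite mulrDl expRD; exact: cvgM|].
Qed.

Lemma expmNV n (w : 'M[C]_n) : expm (- w) *m expm w = 1%:M.
Proof.
rewrite -[X in _ *m expm X]scale1r -scaleN1r -expmD addNr scale0r.
exact: expm0.
Qed.

Lemma expmVN n (w : 'M[C]_n) : expm w *m expm (- w) = 1%:M.
Proof. by rewrite -{1}[w]opprK expmNV. Qed.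

End MatrixExponential.

Section ExponentialDerivative.
Variable R : realType.
Local Notation C := (R[i] : numFieldType).

(** The terms of degree at least 2 carry a factor h^2, the rest being bounded
    termwise by the exponential series of the norm of w. *)
Lemma norm_expm_sub_linear_le n (w : 'M[C]_n) (h : C) a b : `|h| <= 1 ->
  `|(expm (h *: w) - 1%:M - h *: w) a b| <= `|h| ^+ 2 * (expR (mxnorm1 w))%:C%C.
Proof.
move=> h1; rewrite -cabsE -rmorphXn -rmorphM /=.
apply: (@norm_lim_le _ (fun N => (expm_part (h *: w) N - 1%:M - h *: w) a b)).
  apply: mxcvgB (mxcvg_cst _) a b; apply: mxcvgB (mxcvg_cst _).
  exact: cvg_expm.
exists 2%N => // -[|[|N]] // _.
rewrite /expm_part 2!big_ord_recl /= fact0 invr1 scale1r expr0 expr1 scale1r.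
have cancel (A B S : 'M[C]_n) : A + (B + S) - A - B = S.
  by rewrite [A + _]addrC addrK [B + S]addrC addrK.
rewrite cancel.
rewrite summxE rmorphM rmorphXn /= cabsE.
apply: le_trans (ler_norm_sum _ _ _) _.
apply: (@le_trans _ _ (`|h| ^+ 2 * (\sum_(k < N) exp_coeff (mxnorm1 w) k.+2)%:C%C)).
  rewrite rmorph_sum mulr_sumr; apply: ler_sum => k _ /=.
  have -> : (h *: w) ^+ k.+2 = h ^+ k.+2 *: w ^+ k.+2.
    elim: (k.+2) => [|j IH]; first by rewrite scale1r.
    by rewrite !exprS IH -!mulmxE -scalemxAl -scalemxAr scalerA.
  rewrite scalerA mulrC -scalerA mxE [X in `|_ * X|]mxE normrM normrX.
  have hk : `|h| ^+ k.+2 <= `|h| ^+ 2.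
    by rewrite -[k.+2]addn2 exprD ler_piMl ?exprn_ge0// exprn_ile1.
  apply: ler_pM => //; exact: norm_expm_term_le.
rewrite ler_wpM2l ?exprn_ge0// lecR.
have Sinc : {homo series (exp_coeff (mxnorm1 w)) : p q / (p <= q)%N >-> p <= q}.
  apply/nondecreasing_seqP => p; rewrite /series /= big_nat_recr//= lerDl.
  by rewrite exp_coeff_ge0// mxnorm1_ge0.
apply: le_trans (nondecreasing_cvgn_le Sinc (is_cvg_series_exp_coeff _) N.+2).
rewrite /series /= big_mkord 2!big_ord_recl addrA lerDr addr_ge0//.
  by rewrite exp_coeff_ge0// mxnorm1_ge0.
by rewrite exp_coeff_ge0// mxnorm1_ge0.
Qed.

Lemma is_derive_expm_shift n (w : 'M[C]_n) (s : C) a b :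
  is_derive s 1 (fun s' : C => expm ((s' - s) *: w) a b) (w a b).
Proof.
have h : (fun h : C => h^-1 *: (((fun s' : C => expm ((s' - s) *: w) a b) \o shift s)
     (h *: 1) - expm ((s - s) *: w) a b)) @ 0^' --> w a b.
  apply/cvgrPdist_lt => e e0.
  pose K : C := (expR (mxnorm1 w))%:C%C.
  have K0 : 0 < K by rewrite ltcR expR_gt0.
  near=> h.
  have h0 : h != 0 by near: h; exact: nbhs_dnbhs_neq.
  have h1 : `|h| <= 1 by near: h; apply: dnbhs0_le.
  have he : `|h| < e / K by near: h; apply: dnbhs0_lt; rewrite divr_gt0.
  have -> : ((fun s' : C => expm ((s' - s) *: w) a b) \o shift s) (h *: 1) =
      expm (h *: w) a b.
    by rewrite /comp /shift addrK [h *: 1]mulr1.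
  rewrite (subrr s) scale0r expm0.
  have E := norm_expm_sub_linear_le w a b h1.
  have hn : 0 < `|h| by rewrite normr_gt0.
  rewrite -(ltr_pM2l hn) -normrM.
  have -> : h * (w a b - h^-1 *: (expm (h *: w) a b - 1%:M a b)) =
      - (expm (h *: w) - 1%:M - h *: w) a b.
    have entry (A O D : 'M[C]_n) : (A - O - D) a b = A a b - O a b - D a b.
      by rewrite !mxE.
    by rewrite entry mulrBr /GRing.scale /= mulVKf// [(h *: w) a b]mxE [RHS]opprB.
  rewrite normrN (le_lt_trans E)// expr2 -mulrA ltr_pM2l//.
  by move: he; rewrite ltr_pdivlMr.
split; last by apply: cvg_lim h.
by apply/cvg_ex; exists (w a b).
Unshelve. all: by end_near. Qed.

(** By additivity it is enough to differentiate at 0. *)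
Lemma is_derive_expm n (w : 'M[C]_n) (s : C) a b :
  is_derive s 1 (fun s' : C => expm (s' *: w) a b) ((w *m expm (s *: w)) a b).
Proof.
have shiftE : (fun s' : C => expm (s' *: w) a b) =
    (fun s' : C => (expm ((s' - s) *: w) *m expm (s *: w)) a b).
  by apply/funext => s'; rewrite -expmD subrK.
rewrite shiftE.
have dcst := is_derive_entry_cst (expm (s *: w)) s (1 : C).
have := is_derive_mulmx (is_derive_expm_shift w s) dcst a b.
by rewrite mulmx0 add0r.
Qed.

(** The transpose of exp(w/2) is exp(-w/2), so det exp(w/2) squares to 1; and
    exp(w) is the square of exp(w/2). *)
Lemma det_expm_skew n (w : 'M[C]_n) : w^T = - w -> \det (expm w) = 1.
Proof.
move=> wT; have half : 2^-1 + 2^-1 = 1 :> C by rewrite -[2^-1]mul1r -splitr.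
rewrite -[w]scale1r -half.
rewrite expmD det_mulmx -[X in X * _]det_tr trmx_expm linearZ /= wT scalerN.
by rewrite -det_mulmx expmNV det1.
Qed.

End ExponentialDerivative.

(** * The Pfaffian and its gradient *)

Section Pfaffian.
Variable C : numFieldType.

Lemma is_derive_unique (V W : normedModType C) (f : V -> W) x v a b :
  is_derive x v f a -> is_derive x v f b -> a = b.
Proof. by move=> fa fb; rewrite -(@derive_val _ _ _ _ _ _ _ fa) derive_val. Qed.

Lemma mxtrace_delta n (A : 'M[C]_n) a b : \tr (A *m delta_mx b a) = A a b.
Proof.
rewrite /mxtrace (bigD1 a)//= [X in _ + X]big1 => [|i ia].
  rewrite addr0 mxE (bigD1 b)//= [X in _ + X]big1 => [|j jb].
    by rewrite mxE !eqxx mulr1 addr0.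
  by rewrite mxE (negPf jb) mulr0.
by rewrite mxE big1// => j _; rewrite mxE (negPf ia) andbF mulr0.
Qed.

Lemma mxtrace_nondegenerate n (A B : 'M[C]_n) :
  (forall z, \tr (A *m z) = \tr (B *m z)) -> A = B.
Proof. by move=> AB; apply/matrixP => a b; rewrite -!mxtrace_delta. Qed.

Lemma skew_trace_nondegenerate n (A B : 'M[C]_n) : A^T = - A -> B^T = - B ->
  (forall z : 'M[C]_n, z^T = - z -> \tr (A *m z) = \tr (B *m z)) -> A = B.
Proof.
move=> AT BT AB; apply/matrixP => a b.
have skewE (M : 'M[C]_n) : M^T = - M ->
    \tr (M *m (delta_mx b a - delta_mx a b)) = 2 * M a b.
  move=> MT; rewrite mulmxBr raddfB /= !mxtrace_delta.
  have := congr1 (fun N : 'M[C]_n => N a b) MT; rewrite !mxE => ->.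
  by rewrite opprK mulr_natl mulr2n.
have dT : (delta_mx b a - delta_mx a b : 'M[C]_n)^T = - (delta_mx b a - delta_mx a b).
  by rewrite linearB /= !trmx_delta opprB.
have := AB _ dT; rewrite !skewE//; apply: mulfI.
by rewrite pnatr_eq0.
Qed.

Lemma is_derive_prod_ord (V : normedModType C) m (h : 'I_m -> V -> C)
    (dh : 'I_m -> C) x v :
  (forall i, is_derive x v (h i) (dh i)) ->
  is_derive x v (fun y => \prod_i h i y)
    (\sum_i dh i * \prod_(j | j != i) h j x).
Proof.
move=> hdh; apply: (@is_derive_eq _ _ _ _ _ _ _
    (\sum_i \prod_j (if j == i then dh j else h j x))); last first.
  apply: eq_bigr => i _; rewrite (bigD1 i)//= eqxx; congr (_ * _).
  by apply: eq_bigr => j /negPf ->.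
elim: m h dh hdh => [|m IH] h dh hdh.
  rewrite big_ord0; under eq_fun do rewrite big_ord0.
  exact: is_derive_cst.
under eq_fun do rewrite big_ord_recl.
have := is_deriveM (hdh ord0) (IH _ _ (fun i => hdh (lift ord0 i))).
move/is_derive_eq; apply; rewrite [RHS]big_ord_recl [X in _ = X + _]big_ord_recl /= addrC.
congr (_ + _).
  by rewrite /GRing.scale /= mulrC; congr (_ * _); apply: eq_bigr.
rewrite /GRing.scale /= mulr_sumr; apply: eq_bigr => i _.
rewrite big_ord_recl /=; congr (_ * _); exact: eq_bigr.
Qed.

Lemma prod_double (h : nat -> C) m :
  \prod_(0 <= l < m.*2) h l = \prod_(0 <= k < m) (h k.*2 * h k.*2.+1).
Proof.
elim: m => [|m IH]; first by rewrite !big_geq.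
by rewrite doubleS !big_nat_recr//= IH mulrA.
Qed.

Variable n : nat.
Hypothesis n_even : ~~ odd n.
Local Notation lo := (fun k : 'I_n./2 => Ordinal (double_ltn_half k)).
Local Notation hi := (fun k : 'I_n./2 => Ordinal (double_succ_ltn_half k)).

Lemma prod_pairs (h : 'I_n -> C) :
  \prod_l h l = \prod_(k < n./2) (h (lo k) * h (hi k)).
Proof.
pose H l := if insub l is Some i then h i else 1.
have HE (i : 'I_n) : h i = H i by rewrite /H valK.
rewrite (eq_bigr _ (fun i _ => HE i)) -(big_mkord xpredT H).
have nE : n./2.*2 = n by rewrite -[RHS]odd_double_half (negPf n_even).
rewrite -{1}nE prod_double big_mkord.
by apply: eq_bigr => k _; rewrite !HE.
Qed.


(** Reads a family of pairs of columns as one list of n columns.  For n even the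
    last branch is never taken. *)
Definition pair_column (F : {ffun 'I_n./2 -> 'I_n * 'I_n}) (l : 'I_n) : 'I_n :=
  if insub l./2 is Some k then (if odd l then (F k).2 else (F k).1) else l.

(** Right multiplication by this 0/1 matrix extracts the columns listed by F, so
    that sums over permutations become determinants of g times it. *)
Definition pair_selector (F : {ffun 'I_n./2 -> 'I_n * 'I_n}) : 'M[C]_n :=
  \matrix_(j, l) (j == pair_column F l)%:R.

Lemma mul_pair_selector (g : 'M[C]_n) F j l :
  (g *m pair_selector F) j l = g j (pair_column F l).
Proof.
rewrite mxE (bigD1 (pair_column F l))//= big1 => [|i il].
  by rewrite addr0 mxE eqxx mulr1.
by rewrite mxE (negPf il) mulr0.
Qed.

Lemma pair_column_lo F k : pair_column F (lo k) = (F k).1.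
Proof. by rewrite /pair_column /= doubleK valK odd_double. Qed.

Lemma pair_column_hi F k : pair_column F (hi k) = (F k).2.
Proof. by rewrite /pair_column /= uphalf_double valK odd_double. Qed.

(** Expanding each entry of g x g^T over the entries of x and summing over
    permutations first, the coefficient of a product of entries of x is the
    determinant of the matrix of the chosen columns of g, in which det g factors
    out.  The rest of the formula does not involve g. *)
Lemma pfaffian_congruence_expansion (g x : 'M[C]_n) :
  pfaffian (g *m x *m g^T) = ((2 ^ n./2 * (n./2)`!)%:R)^-1 *
    \sum_(F : {ffun 'I_n./2 -> 'I_n * 'I_n})
      (\prod_k x (F k).1 (F k).2) * (\det g * \det (pair_selector F)).
Proof.
rewrite /pfaffian; congr (_ * _).
under eq_bigr => s _.
  rewrite (eq_bigr (fun k => \sum_(p : 'I_n * 'I_n)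
     x p.1 p.2 * (g (s (lo k)) p.1 * g (s (hi k)) p.2))); last first.
    move=> k _; rewrite mxE (eq_bigr (fun b => \sum_a
      x a b * (g (s (lo k)) a * g (s (hi k)) b))); last first.
      move=> b _; rewrite mxE mulr_suml; apply: eq_bigr => a _; rewrite mxE.
      by ring.
    by rewrite exchange_big pair_big.
  rewrite bigA_distr_bigA mulr_sumr.
  over.
rewrite exchange_big /=; apply: eq_bigr => F _.
rewrite -det_mulmx -det_tr mulr_sumr; apply: eq_bigr => s _.
rewrite big_split /= mulrCA; congr (_ * (_ * _)).
rewrite [RHS]prod_pairs; apply: eq_bigr => k _.
by rewrite ![_^T _ _]mxE !mul_pair_selector pair_column_lo pair_column_hi.
Qed.

Lemma pfaffian_congruence (g x : 'M[C]_n) :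
  pfaffian (g *m x *m g^T) = \det g * pfaffian x.
Proof.
have {2}-> : x = 1%:M *m x *m (1%:M)^T by rewrite trmx1 mul1mx mulmx1.
rewrite !pfaffian_congruence_expansion det1 mulrCA; congr (_ * _).
by rewrite mulr_sumr; apply: eq_bigr => F _; ring.
Qed.

(** The partial derivatives of the Pfaffian polynomial with respect to all n^2
    entries, treated as independent variables. *)
Definition pf_partials (x : 'M[C]_n) : 'M[C]_n :=
  ((2 ^ n./2 * (n./2)`!)%:R)^-1 *: \sum_(s : 'S_n) (-1) ^+ s *:
    \sum_k (\prod_(j | j != k) x (s (lo j)) (s (hi j))) *:
      delta_mx (s (lo k)) (s (hi k)).

Lemma is_derive_pfaffian (V : normedModType C) (Y : V -> 'M[C]_n) (dY : 'M[C]_n) x v :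
  (forall a b, is_derive x v (fun y => Y y a b) (dY a b)) ->
  is_derive x v (fun y => pfaffian (Y y)) (\tr ((pf_partials (Y x))^T *m dY)).
Proof.
move=> YdY.
have cst_mul (c : C) (f : V -> C) df : is_derive x v f df ->
    is_derive x v (fun y => c * f y) (c * df) by exact: is_deriveZ.
apply: is_derive_eq.
  apply: (cst_mul); apply: is_derive_bigsum => s _.
  apply: (cst_mul); apply: (@is_derive_prod_ord _ _
    (fun k y => Y y (s (lo k)) (s (hi k))) (fun k => dY (s (lo k)) (s (hi k)))).
rewrite /pf_partials linearZ /= -scalemxAl mxtraceZ; congr (_ * _).
rewrite !(linear_sum, mulmx_suml) /=; apply: eq_bigr => s _.
rewrite linearZ /= -scalemxAl mxtraceZ; congr (_ * _).
rewrite !(linear_sum, mulmx_suml) /=; apply: eq_bigr => k _.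
rewrite linearZ /= -scalemxAl mxtraceZ mulrC; congr (_ * _).
by rewrite trmx_delta mxtrace_mulC mxtrace_delta.
Qed.

(** The trace form pairs z with the transpose of the partials; on skew-symmetric
    z only the skew-symmetric part of that transpose matters, and it belongs to
    so(n), as a gradient must. *)
Definition pf_gradient (x : 'M[C]_n) : 'M[C]_n :=
  2^-1 *: ((pf_partials x)^T - pf_partials x).

Lemma trmx_pf_gradient x : (pf_gradient x)^T = - pf_gradient x.
Proof. by rewrite /pf_gradient linearZ linearB /= trmxK -scalerN opprB. Qed.

Lemma mxtrace_pf_gradient x z : z^T = - z ->
  \tr (pf_gradient x *m z) = \tr ((pf_partials x)^T *m z).
Proof.
move=> zT; rewrite /pf_gradient -scalemxAl mxtraceZ mulmxBl raddfB /=.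
have -> : \tr (pf_partials x *m z) = - \tr ((pf_partials x)^T *m z).
  by rewrite -mxtrace_tr trmx_mul zT mulNmx raddfN /= mxtrace_mulC.
set t := \tr _; by field.
Qed.

Lemma is_derive_line (x z : 'M[C]_n) a b :
  is_derive (0 : C) (1 : C) (fun t : C => (x + t *: z) a b) (z a b).
Proof.
under eq_fun do rewrite mxE [(_ *: z) a b]mxE.
have tz := is_deriveM (is_derive_id (0 : C) (1 : C)) (is_derive_cst (z a b) (0 : C) (1 : C)).
apply: is_derive_eq (is_deriveD (is_derive_cst (x a b) (0 : C) (1 : C)) tz) _.
by rewrite /GRing.scale /= mulr0 mulr1 !add0r.
Qed.

(** Both sides represent the derivative at 0 of t |-> Pf(g x g^T + t z), which
    invariance rewrites as Pf(x + t g^T z g). *)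
Lemma pf_partials_conj (g x : 'M[C]_n) : g^T *m g = 1%:M -> g *m g^T = 1%:M ->
  \det g = 1 -> pf_partials (g *m x *m g^T) = g *m pf_partials x *m g^T.
Proof.
move=> gTg ggT detg; apply: trmx_inj; apply: mxtrace_nondegenerate => z.
have lin := is_derive_pfaffian (is_derive_line (g *m x *m g^T) z).
have := is_derive_pfaffian (is_derive_line x (g^T *m z *m g)).
rewrite !scale0r !addr0 in lin *.
have -> : (fun t : C => pfaffian (x + t *: (g^T *m z *m g))) =
    (fun t : C => pfaffian (g *m x *m g^T + t *: z)).
  apply/funext => t; rewrite -[LHS]mul1r -detg -pfaffian_congruence.
  congr pfaffian; rewrite mulmxDr mulmxDl -scalemxAr -scalemxAl.
  by rewrite !mulmxA ggT mul1mx -!mulmxA ggT mulmx1.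
move/(is_derive_unique lin) => ->.
rewrite !trmx_mul trmxK mulmxA mxtrace_mulC !mulmxA.
by [].
Qed.

Lemma pf_gradient_conj (g x : 'M[C]_n) : g^T *m g = 1%:M -> g *m g^T = 1%:M ->
  \det g = 1 -> pf_gradient (g *m x *m g^T) = g *m pf_gradient x *m g^T.
Proof.
move=> gTg ggT detg; rewrite /pf_gradient pf_partials_conj//.
rewrite !trmx_mul trmxK; move: (pf_partials x) => D.
by rewrite -scalemxAr -scalemxAl mulmxBr mulmxBl !mulmxA.
Qed.

End Pfaffian.

(** * Conjugation by exponentials *)

Section ExpConj.
Variable R : realType.
Local Notation C := (R[i] : numFieldType).

Definition exp_conj n (w x : 'M[C]_n) : 'M[C]_n := expm w *m x *m expm (- w).

Lemma exp_conj0 n (x : 'M[C]_n) : exp_conj 0 x = x.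
Proof. by rewrite /exp_conj oppr0 !expm0 mul1mx mulmx1. Qed.

Lemma exp_conjD n (w x : 'M[C]_n) s t :
  exp_conj ((s + t) *: w) x = exp_conj (s *: w) (exp_conj (t *: w) x).
Proof.
rewrite /exp_conj -!scaleNr opprD expmD [- s + - t]addrC expmD.
by rewrite !mulmxA.
Qed.

Lemma exp_conj_fix n (w x : 'M[C]_n) : x *m w = w *m x -> exp_conj w x = x.
Proof.
by move=> /expm_comm xw; rewrite /exp_conj -xw -mulmxA expmVN mulmx1.
Qed.

Lemma exp_conj_mul n (w x y : 'M[C]_n) :
  exp_conj w (x *m y) = exp_conj w x *m exp_conj w y.
Proof.
rewrite /exp_conj -!mulmxA; congr (_ *m (_ *m _)).
by rewrite [in RHS]mulmxA expmNV mul1mx.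
Qed.

Lemma exp_conj1 n (w : 'M[C]_n) : exp_conj w 1%:M = 1%:M.
Proof. by rewrite /exp_conj mulmx1 expmVN. Qed.

Lemma exp_conjX n (w x : 'M[C]_n) k : exp_conj w (x ^+ k) = exp_conj w x ^+ k.
Proof.
elim: k => [|k IH]; first by rewrite !expr0 exp_conj1.
by rewrite !exprS -!mulmxE exp_conj_mul IH.
Qed.

Lemma exp_conjZ n (w x : 'M[C]_n) c : exp_conj w (c *: x) = c *: exp_conj w x.
Proof. by rewrite /exp_conj -scalemxAr -scalemxAl. Qed.

Lemma exp_conjN n (w x : 'M[C]_n) : exp_conj w (- x) = - exp_conj w x.
Proof. by rewrite /exp_conj mulmxN mulNmx. Qed.

Lemma expm_exp_conj n (u w : 'M[C]_n) :
  expm (exp_conj u w) = exp_conj u (expm w).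
Proof.
have uw : expm u *m w = exp_conj u w *m expm u.
  by rewrite /exp_conj -!mulmxA expmNV mulmx1.
by rewrite [RHS]/exp_conj (expm_intertwine uw) -mulmxA expmVN mulmx1.
Qed.

Lemma exp_conj_conj n (u w x : 'M[C]_n) :
  exp_conj (exp_conj u w) (exp_conj u x) = exp_conj u (exp_conj w x).
Proof.
by rewrite {1}/exp_conj -exp_conjN !expm_exp_conj -!exp_conj_mul.
Qed.

(** With A the first rows of the identity matrix and B its transpose, A x B is a
    cutoff: conjugation by the exponential of a block matrix restricts to
    conjugation by the exponential of the block; exchanging A and B gives the
    analogue for the embedding of blocks. *)
Lemma exp_conj_intertwine m n (A : 'M[C]_(m, n)) (B : 'M[C]_(n, m))
    (w : 'M[C]_n) (w' : 'M[C]_m) (x : 'M[C]_n) :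
  A *m w = w' *m A -> B *m w' = w *m B ->
  A *m exp_conj w x *m B = exp_conj w' (A *m x *m B).
Proof.
move=> Aw Bw; have BNw : B *m (- w') = (- w) *m B by rewrite mulmxN mulNmx Bw.
rewrite /exp_conj !mulmxA (expm_intertwine Aw) -!mulmxA.
by rewrite -(expm_intertwine BNw).
Qed.

Lemma trmx_exp_conj n (w x : 'M[C]_n) : w^T = - w ->
  (exp_conj w x)^T = exp_conj w x^T.
Proof.
by move=> wT; rewrite /exp_conj !trmx_mul !trmx_expm linearN /= wT opprK mulmxA.
Qed.

Lemma is_derive_exp_conj n (w x : 'M[C]_n) (s : C) a b :
  is_derive s 1 (fun s' : C => exp_conj (s' *: w) x a b)
    ((w *m exp_conj (s *: w) x - exp_conj (s *: w) x *m w) a b).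
Proof.
have dl := is_derive_mulmx (is_derive_expm w s) (is_derive_entry_cst x s (1 : C)).
have := is_derive_mulmx dl (is_derive_expm (- w) s) a b.
have -> : (fun y : C => (expm (y *: w) *m x *m expm (y *: - w)) a b) =
    (fun s' : C => exp_conj (s' *: w) x a b).
  by apply/funext => y; rewrite /exp_conj scalerN.
move/is_derive_eq; apply.
congr (fun_of_matrix _ _ _).
have -> : - w *m expm (s *: - w) = - (expm (s *: - w) *m w).
  rewrite mulNmx (@expm_comm _ _ w)// -scalemxAr mulmxN.
  by rewrite scalerN -scalemxAl mulNmx scalerN.
rewrite /exp_conj scalerN mulmx0 add0r mulmxN addrC.
by rewrite !mulmxA.
Qed.

Lemma is_derive_exp_conjN n (v x : 'M[C]_n) (s : C) a b :
  is_derive s 1 (fun s' : C => exp_conj (- s' *: v) x a b)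
    (bracket (exp_conj (- s *: v) x) v a b).
Proof.
have := is_derive_exp_conj (- v) x s a b.
under eq_fun do rewrite scalerN -scaleNr.
by rewrite scalerN -scaleNr mulNmx mulmxN opprK addrC.
Qed.

(** Differentiating the constant Pf(exp(t w) x exp(-t w)) at 0 shows that the
    gradient v is orthogonal to [w, x], that is [x, v] to w, for every w of
    so(n); and [x, v] is in so(n), where the trace form is nondegenerate. *)
Lemma pf_gradient_comm n (x : 'M[C]_n) : ~~ odd n -> x^T = - x ->
  x *m pf_gradient x = pf_gradient x *m x.
Proof.
move=> n_even xT; apply/eqP; rewrite -subr_eq0; apply/eqP.
set v := pf_gradient x; have vT : v^T = - v by exact: trmx_pf_gradient.
apply: skew_trace_nondegenerate => [||w wT].
- by rewrite linearB /= !trmx_mul vT xT !mulNmx !mulmxN !opprK opprB.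
- by rewrite trmx0 oppr0.
rewrite mul0mx linear0.
have -> : \tr ((x *m v - v *m x) *m w) = \tr (v *m (w *m x - x *m w)).
  rewrite mulmxBl mulmxBr !raddfB /= -[x *m v *m w]mulmxA mxtrace_mulC.
  by rewrite -!mulmxA.
rewrite mxtrace_pf_gradient; last first.
  by rewrite linearB /= !trmx_mul wT xT !mulNmx !mulmxN !opprK opprB.
have dY a b := is_derive_exp_conj w x 0 a b.
have := is_derive_pfaffian dY.
rewrite scale0r exp_conj0 => dpf.
apply: is_derive_unique dpf _.
have -> : (fun y : C => pfaffian (exp_conj (y *: w) x)) = cst (pfaffian x).
  apply/funext => t; rewrite /exp_conj -scalerN -wT -linearZ /= -trmx_expm.
  rewrite pfaffian_congruence// det_expm_skew ?mul1r//.
  by rewrite linearZ /= wT scalerN.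
exact: is_derive_cst.
Qed.

Lemma pf_gradient_exp_conj n (w x : 'M[C]_n) : ~~ odd n -> w^T = - w ->
  pf_gradient (exp_conj w x) = exp_conj w (pf_gradient x).
Proof.
move=> n_even wT; rewrite /exp_conj -wT -trmx_expm pf_gradient_conj//.
- by rewrite trmx_expm wT expmNV.
- by rewrite trmx_expm wT expmVN.
- exact: det_expm_skew.
Qed.

End ExpConj.

(** * Gradients of the basic invariants *)

Section InvariantGradient.
Variable R : realType.
Local Notation C := (R[i] : numFieldType).

(** Since Y and its derivative need not commute, the derivative of Y^j is only
    described through its traces against powers of Y, where the factors can be
    permuted cyclically; the extra factor Y^m makes the induction work. *)
Lemma is_derive_mxpow (V : normedModType C) n (Y : V -> 'M[C]_n) (dY : 'M[C]_n) x v j :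
  (forall a b, is_derive x v (fun y => Y y a b) (dY a b)) ->
  exists dP : 'M[C]_n, (forall a b, is_derive x v (fun y => (Y y ^+ j) a b) (dP a b)) /\
    forall m, \tr (Y x ^+ m *m dP) = j%:R * \tr (Y x ^+ (m + j).-1 *m dY).
Proof.
move=> YdY; elim: j => [|j [dP [dPE trP]]].
  exists 0; split => [a b|m]; first exact: is_derive_entry_cst.
  by rewrite mulmx0 linear0 mul0r.
exists (Y x *m dP + dY *m Y x ^+ j); split => [a b|m].
  have := is_derive_mulmx YdY dPE a b.
  rewrite (_ : (fun y => (Y y *m Y y ^+ j) a b) = (fun y => (Y y ^+ j.+1) a b))//.
  by apply/funext => y; rewrite exprS.
have mul_pow q : Y x ^+ q *m Y x = Y x ^+ q.+1 by rewrite exprSr.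
rewrite mulmxDr raddfD /= mulmxA mul_pow trP addSn /=.
have -> : \tr (Y x ^+ m *m (dY *m Y x ^+ j)) = \tr (Y x ^+ (m + j) *m dY).
  by rewrite mulmxA mxtrace_mulC mulmxA mulmxE -exprD addnC.
by rewrite addnS /= -[in RHS]natr1 mulrDl mul1r.
Qed.

Lemma is_derive_mxtrace (V : normedModType C) n (Y : V -> 'M[C]_n) (dY : 'M[C]_n) x v :
  (forall a b, is_derive x v (fun y => Y y a b) (dY a b)) ->
  is_derive x v (fun y => \tr (Y y)) (\tr dY).
Proof. by move=> YdY; apply: is_derive_bigsum. Qed.

Lemma is_derive_trace_pow (V : normedModType C) n (Y : V -> 'M[C]_n) (dY : 'M[C]_n) x v j :
  (forall a b, is_derive x v (fun y => Y y a b) (dY a b)) ->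
  is_derive x v (fun y => \tr (Y y ^+ j)) (\tr (j%:R *: Y x ^+ j.-1 *m dY)).
Proof.
move=> /(@is_derive_mxpow _ _ _ _ _ _ j)[dP [/is_derive_mxtrace dPE trP]].
apply: is_derive_eq dPE _.
by have := trP 0%N; rewrite expr0 mul1mx -scalemxAl mxtraceZ.
Qed.

Definition inv_gradient (k : lie_type) (i j : nat) (y : 'M[C]_i) : 'M[C]_i :=
  match k with
  | GL => j%:R *: y ^+ j.-1
  | SO => if ~~ odd i && (j == i./2) then pf_gradient y
          else (2 * j)%:R *: y ^+ (2 * j).-1
  end.

Lemma mem_SO n (x : 'M[C]_n) : reflect (x^T = - x) (x \in lie_alg C SO n).
Proof. by rewrite mem_lie_alg_SO; exact: eqP. Qed.

Lemma comm_mxpow n (y : 'M[C]_n) j : y *m y ^+ j = y ^+ j *m y.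
Proof. by rewrite !mulmxE -exprS -exprSr. Qed.

Lemma inv_gradient_comm k i j (y : 'M[C]_i) : y \in lie_alg C k i ->
  y *m inv_gradient k j y = inv_gradient k j y *m y.
Proof.
case: k => [_|/mem_SO yT] /=.
  by rewrite -scalemxAr -scalemxAl comm_mxpow.
case: ifPn => [/andP[i_even _]|_]; first exact: pf_gradient_comm.
by rewrite -scalemxAr -scalemxAl comm_mxpow.
Qed.

Lemma inv_gradient_exp_conj k i j (w y : 'M[C]_i) : w \in lie_alg C k i ->
  inv_gradient k j (exp_conj w y) = exp_conj w (inv_gradient k j y).
Proof.
case: k => [_|/mem_SO wT] /=; first by rewrite [RHS]exp_conjZ exp_conjX.
case: (boolP (~~ odd i && _)) => [/andP[i_even _]|_].
  exact: pf_gradient_exp_conj.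
by rewrite [RHS]exp_conjZ exp_conjX.
Qed.

Lemma inv_gradient_in k i j (y : 'M[C]_i) : (0 < j)%N -> y \in lie_alg C k i ->
  inv_gradient k j y \in lie_alg C k i.
Proof.
case: k => [_ _|j0 /mem_SO yT]; first exact: memvf.
apply/mem_SO => /=; case: ifP => _; first exact: trmx_pf_gradient.
have -> : (2 * j).-1 = (j.-1.*2.+1)%N by lia.
rewrite linearZ /= trmx_expn yT -scalerN; congr (_ *: _).
elim: (j.-1) => [|m IH]; first by rewrite !expr1.
rewrite doubleS; move: (m.*2.+1) IH => q IH.
rewrite !exprS IH -!mulmxE !mulNmx !mulmxN !opprK.
by [].
Qed.

Lemma is_derive_invariant k i j (y z : 'M[C]_i) : z \in lie_alg C k i ->
  is_derive (0 : C) (1 : C) (fun t : C => Defs.invariant k j (y + t *: z))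
    (\tr (inv_gradient k j y *m z)).
Proof.
have line := is_derive_line y z.
have trace j' : is_derive (0 : C) (1 : C) (fun t : C => \tr ((y + t *: z) ^+ j'))
    (\tr (j'%:R *: y ^+ j'.-1 *m z)).
  by have := is_derive_trace_pow j' line; rewrite scale0r addr0.
case: k => [_|/mem_SO zT] /=; first exact: trace.
case: ifP => _; last exact: trace.
by have := is_derive_pfaffian line; rewrite scale0r addr0 mxtrace_pf_gradient.
Qed.

End InvariantGradient.

(** * Cutoffs as products with corner matrices *)

Section Cutoff.
Variable R : realType.
Local Notation C := (R[i] : numFieldType).
Variable n : nat.

Definition corner i (le_in : (i <= n)%N) : 'M[C]_(i, n) :=
  \matrix_(a, b) (b == widen_ord le_in a)%:R.

Lemma mul_corner i (le_in : (i <= n)%N) m (x : 'M[C]_(n, m)) a b :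
  (corner le_in *m x) a b = x (widen_ord le_in a) b.
Proof.
rewrite mxE (bigD1 (widen_ord le_in a))//= big1 => [|c ca].
  by rewrite addr0 mxE eqxx mul1r.
by rewrite mxE (negPf ca) mul0r.
Qed.

Lemma cutoffE i (le_in : (i <= n)%N) (x : 'M[C]_n) :
  cutoff le_in x = corner le_in *m x *m (corner le_in)^T.
Proof.
apply/matrixP => a b; rewrite mxE -mulmxA mul_corner.
by rewrite -[x in RHS]trmxK -trmx_mul mxE mul_corner mxE.
Qed.

Lemma corner_tr i (le_in : (i <= n)%N) : corner le_in *m (corner le_in)^T = 1%:M.
Proof.
apply/matrixP => a b; rewrite mul_corner !mxE -val_eqE /=.
by [].
Qed.

(** The first i coordinates are unchanged by the projection onto the first j. *)
Lemma corner_nest i j (le_in : (i <= n)%N) (le_jn : (j <= n)%N) : (i <= j)%N ->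
  corner le_in *m ((corner le_jn)^T *m corner le_jn) = corner le_in.
Proof.
move=> le_ij; apply/matrixP => a b; rewrite mul_corner.
have -> : widen_ord le_in a = widen_ord le_jn (widen_ord le_ij a) by apply/val_inj.
rewrite -mul_corner mulmxA corner_tr mul1mx !mxE.
congr ((b == _)%:R); exact: val_inj.
Qed.

Lemma tr_corner_nest i j (le_in : (i <= n)%N) (le_jn : (j <= n)%N) : (i <= j)%N ->
  (corner le_jn)^T *m corner le_jn *m (corner le_in)^T = (corner le_in)^T.
Proof.
by move=> le_ij; apply: trmx_inj; rewrite !trmx_mul !trmxK corner_nest.
Qed.

Lemma cutoff_in k i (le_in : (i <= n)%N) x : x \in lie_alg C k n ->
  cutoff le_in x \in lie_alg C k i.
Proof.
case: k => [_|/mem_SO xT]; first exact: memvf.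
by apply/mem_SO; rewrite cutoffE !trmx_mul trmxK xT mulNmx mulmxN !mulmxA.
Qed.

End Cutoff.

(** * The commuting flows *)

Section GelfandZeitlinFlows.
Variable R : realType.
Local Notation C := (R[i] : numFieldType).
Variables (k : lie_type) (n : nat).
Implicit Types (p q : gz_index k n) (x y : 'M[C]_n) (s t : C).

Definition level p : nat := (tag p).+1.

Local Notation J p := (corner R (level_leq (tag p))).

Definition gz_gradient p x : 'M[C]_n :=
  (J p)^T *m inv_gradient k (tagged p).+1 (cutoff (level_leq (tag p)) x) *m J p.

Lemma cutoff_gz_gradient p x :
  cutoff (level_leq (tag p)) (gz_gradient p x) =
  inv_gradient k (tagged p).+1 (cutoff (level_leq (tag p)) x).
Proof.
rewrite cutoffE /gz_gradient !mulmxA corner_tr mul1mx -mulmxA.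
by rewrite corner_tr mulmx1.
Qed.

Lemma gz_gradient_in p x : x \in lie_alg C k n -> gz_gradient p x \in lie_alg C k n.
Proof.
move=> /(cutoff_in (level_leq (tag p))) /(inv_gradient_in (ltn0Sn (tagged p))).
rewrite /gz_gradient; move: (inv_gradient _ _ _) => G.
clear; case: k p G => p G; first by move=> _; exact: memvf.
move=> /mem_SO GT; apply/mem_SO.
by rewrite !trmx_mul trmxK GT mulNmx mulmxN mulmxA.
Qed.

Lemma lie_alg_nondegenerate x y : x \in lie_alg C k n -> y \in lie_alg C k n ->
  (forall z, z \in lie_alg C k n -> \tr (x *m z) = \tr (y *m z)) -> x = y.
Proof.
clear; case: k => [_ _ xy|/mem_SO xT /mem_SO yT xy].
  by apply: mxtrace_nondegenerate => z; apply: xy; exact: memvf.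
by apply: skew_trace_nondegenerate => // z zT; apply: xy; exact/mem_SO.
Qed.

Lemma is_gradient_gz_gradient p x : x \in lie_alg C k n ->
  is_gradient k (gz_fun p) x (gz_gradient p x).
Proof.
move=> x_in; split=> [|z z_in]; first exact: gz_gradient_in.
have -> : (fun t : C => gz_fun p (x + t *: z)) =
    (fun t : C => Defs.invariant k (tagged p).+1
       (cutoff (level_leq (tag p)) x + t *: cutoff (level_leq (tag p)) z)).
  apply/funext => t; rewrite /gz_fun !cutoffE.
  by rewrite mulmxDr mulmxDl -scalemxAr -scalemxAl.
have -> : \tr (gz_gradient p x *m z) =
    \tr (inv_gradient k (tagged p).+1 (cutoff (level_leq (tag p)) x)
         *m cutoff (level_leq (tag p)) z).
  by rewrite /gz_gradient [cutoff _ z]cutoffE -!mulmxA mxtrace_mulC -!mulmxA.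
exact: is_derive_invariant (cutoff_in _ z_in).
Qed.

Lemma gradient_gz_fun p x : x \in lie_alg C k n ->
  gradient k (gz_fun p) x = gz_gradient p x.
Proof.
move=> x_in; apply: xget_unique; first exact: is_gradient_gz_gradient.
move=> v [v_in vE]; apply: lie_alg_nondegenerate => //.
  exact: gz_gradient_in.
move=> z z_in; apply: is_derive_unique (vE z z_in) _.
by have [_] := is_gradient_gz_gradient p x_in; apply.
Qed.

Definition gz_flow p t x : 'M[C]_n := exp_conj (- t *: gz_gradient p x) x.

Lemma gz_flowE p t x : gz_flow p t x = exp_conj (- t *: gz_gradient p x) x.
Proof. by []. Qed.

Lemma exp_conj_in (w x : 'M[C]_n) : w \in lie_alg C k n ->
  x \in lie_alg C k n -> exp_conj w x \in lie_alg C k n.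
Proof.
clear; case: k => [_ _|/mem_SO wT /mem_SO xT]; first exact: memvf.
by apply/mem_SO; rewrite trmx_exp_conj// xT exp_conjN.
Qed.

Lemma gz_flow_in p t x : x \in lie_alg C k n -> gz_flow p t x \in lie_alg C k n.
Proof. by move=> x_in; rewrite exp_conj_in// rpredZ// gz_gradient_in. Qed.

Lemma corner_gz_gradient p q t x : (level p <= level q)%N ->
  J q *m (t *: gz_gradient p x) =
    (t *: cutoff (level_leq (tag q)) (gz_gradient p x)) *m J q.
Proof.
move=> le_pq; rewrite -scalemxAl -scalemxAr cutoffE; congr (_ *: _).
rewrite -!mulmxA; congr (_ *m _).
by rewrite /gz_gradient -!mulmxA corner_nest.
Qed.

Lemma tr_corner_gz_gradient p q t x : (level p <= level q)%N ->
  (J q)^T *m (t *: cutoff (level_leq (tag q)) (gz_gradient p x)) =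
  (t *: gz_gradient p x) *m (J q)^T.
Proof.
move=> le_pq; rewrite -scalemxAl -scalemxAr cutoffE; congr (_ *: _).
by rewrite /gz_gradient !mulmxA tr_corner_nest.
Qed.

Lemma cutoff_exp_conj p q t x y : (level p <= level q)%N ->
  cutoff (level_leq (tag q)) (exp_conj (t *: gz_gradient p x) y) =
  exp_conj (t *: cutoff (level_leq (tag q)) (gz_gradient p x))
    (cutoff (level_leq (tag q)) y).
Proof.
move=> le_pq; rewrite [LHS]cutoffE [cutoff _ y]cutoffE.
apply: exp_conj_intertwine; first exact: corner_gz_gradient.
by rewrite tr_corner_gz_gradient.
Qed.

(** The conjugator of the flow at the lower level restricts to the corner of
    level q as the exponential of an element of g_q, to which the equivariance
    of the gradient of the invariant of g_q applies. *)
Lemma gz_gradient_flow_above p q t x : (level p <= level q)%N ->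
  x \in lie_alg C k n ->
  gz_gradient q (gz_flow p t x) = exp_conj (- t *: gz_gradient p x) (gz_gradient q x).
Proof.
move=> le_pq x_in; rewrite /gz_gradient -/(gz_gradient p x) /gz_flow.
rewrite cutoff_exp_conj// inv_gradient_exp_conj; last first.
  by rewrite rpredZ// cutoff_in// gz_gradient_in.
apply: exp_conj_intertwine.
  by rewrite tr_corner_gz_gradient.
exact: corner_gz_gradient.
Qed.

(** The flow at level q conjugates the cutoff of level q by the exponential of a
    matrix commuting with it, hence fixes it and all smaller cutoffs. *)
Lemma gz_gradient_flow_below p q t x : (level p <= level q)%N ->
  x \in lie_alg C k n -> gz_gradient p (gz_flow q t x) = gz_gradient p x.
Proof.
move=> le_pq x_in.
have fix_q : cutoff (level_leq (tag q)) (gz_flow q t x) = cutoff (level_leq (tag q)) x.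
  rewrite /gz_flow cutoff_exp_conj// cutoff_gz_gradient.
  apply: exp_conj_fix; rewrite -scalemxAr -scalemxAl inv_gradient_comm//.
  exact: cutoff_in.
have nestT := tr_corner_nest R (level_leq (tag p)) (level_leq (tag q)) le_pq.
have cutE y : cutoff (level_leq (tag p)) y =
    J p *m (J q)^T *m cutoff (level_leq (tag q)) y *m (J q *m (J p)^T).
  rewrite !cutoffE -{1}(corner_nest R (level_leq (tag p)) (level_leq (tag q)) le_pq).
  by rewrite -{1}nestT !mulmxA.
by rewrite /gz_gradient (cutE (gz_flow q t x)) fix_q -cutE.
Qed.

Lemma gz_flow0 p x : gz_flow p 0 x = x.
Proof. by rewrite /gz_flow oppr0 scale0r exp_conj0. Qed.

Lemma gz_flowD p s t x : x \in lie_alg C k n ->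
  gz_flow p (s + t) x = gz_flow p s (gz_flow p t x).
Proof.
move=> x_in; rewrite [RHS]gz_flowE (gz_gradient_flow_below _ (leqnn _) x_in).
by rewrite !gz_flowE opprD exp_conjD.
Qed.

(** Both composites conjugate x by the product of the two exponentials taken at
    x, the one of lower level on the left. *)
Lemma gz_flowC p q s t x : x \in lie_alg C k n ->
  gz_flow p s (gz_flow q t x) = gz_flow q t (gz_flow p s x).
Proof.
wlog le_pq : p q s t / (level p <= level q)%N.
  move=> H x_in; have [le_pq|/ltnW le_qp] := leqP (level p) (level q).
    exact: H.
  by rewrite -(H q p).
move=> x_in; rewrite [LHS]gz_flowE (gz_gradient_flow_below _ le_pq x_in).
rewrite [RHS]gz_flowE (gz_gradient_flow_above _ le_pq x_in) -exp_conjZ.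
by rewrite !gz_flowE exp_conj_conj.
Qed.

Lemma is_derive_gz_flow p x s : x \in lie_alg C k n ->
  is_derive s (1 : C) (fun s' : C => gz_flow p s' x) (gz_field p (gz_flow p s x)).
Proof.
move=> x_in; apply: is_derive_mx => a b.
rewrite /gz_field /hamiltonian_field gradient_gz_fun ?gz_flow_in//.
rewrite (gz_gradient_flow_below _ (leqnn _) x_in).
exact: is_derive_exp_conjN.
Qed.

End GelfandZeitlinFlows.

(** * Summable expansions into polynomials *)

Section PowerSeries.
Variable R : realType.
Local Notation C := (R[i] : numFieldType).
Variable I : finType.
Implicit Types (h : {ffun I -> C}) (F G : {ffun I -> C} -> C) (B : R).

Definition monomial h (m : {ffun I -> nat}) : C := \prod_e h e ^+ m e.

Definition eval_terms (L : seq (C * {ffun I -> nat})) h : C :=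
  \sum_(c <- L) c.1 * monomial h c.2.

(** F is a polynomial and B bounds the sum of the moduli of its coefficients.
    This sum bounds F on the unit polydisc, and it is submultiplicative.
    Polynomials are lists of terms with possible repetitions, so that a product
    is the list of all products of terms, with no collection of like terms. *)
Definition poly_le F B : Prop := exists L : seq (C * {ffun I -> nat}),
  (forall h, F h = eval_terms L h) /\ \sum_(c <- L) cabs c.1 <= B.

Lemma cabs0 : cabs (0 : C) = 0.
Proof. by rewrite /cabs normr0. Qed.

Lemma cabsM (x y : C) : cabs (x * y) = cabs x * cabs y.
Proof. by apply: complexI; rewrite rmorphM /= !cabsE normrM. Qed.

Lemma poly_le_bound_ge0 F B : poly_le F B -> 0 <= B.
Proof.
by move=> [L [_]]; apply: le_trans; apply: sumr_ge0 => c _; exact: cabs_ge0.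
Qed.

Lemma poly_le_weaken F B B' : B <= B' -> poly_le F B -> poly_le F B'.
Proof. by move=> BB' [L [LF LB]]; exists L; split => //; exact: le_trans BB'. Qed.

Lemma poly_le_cst c : poly_le (fun=> c) (cabs c).
Proof.
exists [:: (c, [ffun=> 0%N])]; split=> [h|]; last by rewrite big_seq1.
rewrite /eval_terms big_seq1 /monomial big1 ?mulr1// => e _.
by rewrite ffunE expr0.
Qed.

Lemma poly_le_coord e : poly_le (fun h => h e) 1.
Proof.
exists [:: (1, [ffun e' => (e' == e) : nat])]; split=> [h|].
  rewrite /eval_terms big_seq1 /monomial mul1r (bigD1 e)//= big1 => [|e' e'e].
    by rewrite ffunE eqxx expr1 mulr1.
  by rewrite ffunE (negPf e'e) expr0.
by rewrite big_seq1 -lecR cabsE normr1.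
Qed.

Lemma poly_leD F G B B' : poly_le F B -> poly_le G B' ->
  poly_le (fun h => F h + G h) (B + B').
Proof.
move=> [L [LF LB]] [L' [LG LB']]; exists (L ++ L'); split=> [h|].
  by rewrite /eval_terms big_cat LF LG.
by rewrite big_cat lerD.
Qed.

Lemma monomialD h (m m' : {ffun I -> nat}) :
  monomial h [ffun e => (m e + m' e)%N] = monomial h m * monomial h m'.
Proof.
rewrite /monomial -big_split /=; apply: eq_bigr => e _.
by rewrite ffunE exprD.
Qed.

Lemma poly_leM F G B B' : poly_le F B -> poly_le G B' ->
  poly_le (fun h => F h * G h) (B * B').
Proof.
move=> [L [LF LB]] [L' [LG LB']].
pose mul_term (c d : C * {ffun I -> nat}) : C * {ffun I -> nat} :=
  (c.1 * d.1, [ffun e => (c.2 e + d.2 e)%N]).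
exists [seq mul_term c d | c <- L, d <- L'].
split=> [h|].
  rewrite /eval_terms big_allpairs_dep /= LF LG mulr_suml.
  apply: eq_bigr => c _; rewrite mulr_sumr; apply: eq_bigr => d _.
  by rewrite /= monomialD mulrACA.
rewrite big_allpairs_dep /=.
apply: (@le_trans _ _ ((\sum_(c <- L) cabs c.1) * (\sum_(d <- L') cabs d.1))).
  rewrite mulr_suml le_eqVlt; apply/orP; left; apply/eqP.
  apply: eq_bigr => c _; rewrite mulr_sumr; apply: eq_bigr => d _.
  by rewrite /= cabsM.
by apply: ler_pM => //; apply: sumr_ge0 => c _; exact: cabs_ge0.
Qed.

Lemma poly_le_sum (K : Type) (r : seq K) (F : K -> {ffun I -> C} -> C) (B : K -> R) :
  (forall i, poly_le (F i) (B i)) ->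
  poly_le (fun h => \sum_(i <- r) F i h) (\sum_(i <- r) B i).
Proof.
move=> FB; elim: r => [|i r IH].
  rewrite big_nil -cabs0; have -> : (fun h => \sum_(i <- [::]) F i h) = fun=> 0.
    by apply/funext => h; rewrite big_nil.
  exact: poly_le_cst.
rewrite big_cons; have -> : (fun h => \sum_(j <- i :: r) F j h) =
    fun h => F i h + \sum_(j <- r) F j h.
  by apply/funext => h; rewrite big_cons.
exact: poly_leD.
Qed.

(** A series of polynomials on the unit polydisc whose coefficient sums are
    summable: an absolutely convergent power series whose terms have been
    grouped into finite packets. *)
Definition summable_expansion F : Prop :=
  exists (f : nat -> {ffun I -> C} -> C) (b : nat -> R) (W : R),
  [/\ forall k, poly_le (f k) (b k), forall N, \sum_(k < N) b k <= W
    & forall h, (forall e, `|h e| < 1) ->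
        (fun N => \sum_(k < N) f k h) @ \oo --> F h].

Lemma summable_poly F B : poly_le F B -> summable_expansion F.
Proof.
move=> FB; exists (fun k => if k == 0%N then F else fun=> 0),
  (fun k => if k == 0%N then B else 0), B; split.
- by move=> [|k] //=; rewrite -cabs0; exact: poly_le_cst.
- case=> [|N]; first by rewrite big_ord0 (poly_le_bound_ge0 FB).
  by rewrite big_ord_recl /= big1 ?addr0.
- move=> h _; apply: cvg_near_cst; exists 1%N => // -[//|N] _.
  by rewrite big_ord_recl /= big1 ?addr0.
Qed.

Lemma summableD F G : summable_expansion F -> summable_expansion G ->
  summable_expansion (fun h => F h + G h).
Proof.
move=> [f [b [W [fb bW fF]]]] [g [d [W' [gd dW' gG]]]].
exists (fun k h => f k h + g k h), (fun k => b k + d k), (W + W'); split.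
- by move=> k; exact: poly_leD.
- by move=> N; rewrite big_split lerD.
- move=> h h1; under eq_fun do rewrite big_split /=.
  by apply: cvgD; [exact: fF|exact: gG].
Qed.

(** The packets of a product: the j-th summand is the increment of the product
    of the partial sums.  Applied to the bounds as well, it shows that the bound
    of the product is the product of the bounds. *)
Lemma sum_telescope_mul (K : comNzRingType) (f g : nat -> K) N :
  \sum_(j < N) ((\sum_(k < j.+1) f k) * g j + f j * \sum_(k < j) g k) =
  (\sum_(k < N) f k) * (\sum_(k < N) g k).
Proof.
elim: N => [|N IH]; first by rewrite !big_ord0 mul0r.
by rewrite big_ord_recr /= IH !big_ord_recr /=; ring.
Qed.

Lemma summableM F G : summable_expansion F -> summable_expansion G ->
  summable_expansion (fun h => F h * G h).
Proof.
move=> [f [b [W [fb bW fF]]]] [g [d [W' [gd dW' gG]]]].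
exists (fun j h => (\sum_(k < j.+1) f k h) * g j h + f j h * \sum_(k < j) g k h).
exists (fun j => (\sum_(k < j.+1) b k) * d j + b j * \sum_(k < j) d k).
exists (W * W'); split.
- move=> j; apply: poly_leD; apply: poly_leM => //;
  by apply: poly_le_sum => i.
- move=> N; rewrite sum_telescope_mul.
  apply: ler_pM => //; apply: sumr_ge0 => l _.
    exact: poly_le_bound_ge0 (fb l).
  exact: poly_le_bound_ge0 (gd l).
- move=> h h1.
  under eq_fun do rewrite (sum_telescope_mul (fun k => f k h) (fun k => g k h)).
  by apply: cvgM; [exact: fF|exact: gG].
Qed.

Lemma summable_expm n (w : {ffun I -> C} -> 'M[C]_n) (a b : 'I_n) :
  (forall i j, exists B, poly_le (fun h => w h i j) B) ->
  summable_expansion (fun h => expm (w h) a b).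
Proof.
move=> w_poly.
have [Bf wB] : {Bf : 'I_n * 'I_n -> R &
    forall ij, poly_le (fun h => w h ij.1 ij.2) (Bf ij)}.
  apply: (choice (P := fun ij B => poly_le (fun h => w h ij.1 ij.2) B)) => ij.
  exact: w_poly.
pose B := \sum_i \sum_j Bf (i, j).
have Bf0 ij : 0 <= Bf ij by exact: poly_le_bound_ge0 (wB ij).
have B0 : 0 <= B by do 2!apply: sumr_ge0 => ? _.
have rowB i : \sum_j Bf (i, j) <= B.
  rewrite /B [leRHS](bigD1 i)//= lerDl; by do 2!apply: sumr_ge0 => ? _.
have powB k i j : poly_le (fun h => (w h ^+ k) i j) (B ^+ k).
  elim: k i j => [|k IH] i j.
    have -> : (fun h => (w h ^+ 0) i j) = fun=> (1%:M : 'M[C]_n) i j.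
      by apply/funext => h; rewrite expr0.
    apply: poly_le_weaken (poly_le_cst _).
    by rewrite -lecR cabsE expr0 mxE; case: eqP; rewrite ?normr1 ?normr0 ?lexx ?ler01.
  have -> : (fun h => (w h ^+ k.+1) i j) = fun h => \sum_l w h i l * (w h ^+ k) l j.
    by apply/funext => h; rewrite exprS mxE.
  apply: (@poly_le_weaken _ (\sum_l Bf (i, l) * B ^+ k)).
    by rewrite -mulr_suml exprS ler_wpM2r// exprn_ge0.
  by apply: poly_le_sum => l; apply: poly_leM => //; exact: (wB (i, l)).
exists (fun k h => (k`!%:R)^-1 * (w h ^+ k) a b), (exp_coeff B), (expR B); split.
- move=> k; rewrite /exp_coeff /= mulrC.
  apply: poly_leM => //; apply: poly_le_weaken (poly_le_cst _).
  rewrite -lecR cabsE fmorphV rmorph_nat ger0_norm ?invr_ge0//.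
- move=> N; rewrite -(big_mkord xpredT (exp_coeff B)).
  apply: (@nondecreasing_cvgn_le _ (series (exp_coeff B))).
    apply/nondecreasing_seqP => p; rewrite /series /= big_nat_recr//= lerDl.
    by rewrite exp_coeff_ge0.
  exact: is_cvg_series_exp_coeff.
- move=> h _; have := @cvg_expm _ _ (w h) a b; rewrite expm_partE /series /=.
  by under eq_fun do rewrite big_mkord.
Qed.


Lemma norm_monomial_le h m : (forall e, `|h e| < 1) -> `|monomial h m| <= 1.
Proof.
move=> h1; rewrite normr_prod; apply: prodr_ile1 => e _.
by rewrite normr_ge0 normrX exprn_ile1// ltW// h1.
Qed.

(** Collecting like terms: only the terms with an exponent in A are collected. *)
Lemma regroup_terms h (L : seq (C * {ffun I -> nat})) (A : {fset {ffun I -> nat}}) :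
  \sum_(m <- A) (\sum_(c <- L | c.2 == m) c.1) * monomial h m =
  \sum_(c <- L | c.2 \in A) c.1 * monomial h c.2.
Proof.
transitivity (\sum_(m <- A) \sum_(c <- L) (if c.2 == m then c.1 * monomial h c.2 else 0)).
  apply: eq_bigr => m _; rewrite mulr_suml big_mkcond /=.
  by apply: eq_bigr => c _; case: eqP => [->|].
rewrite exchange_big /= [RHS]big_mkcond; apply: eq_bigr => c _.
case: ifPn => cA.
  rewrite (bigD1_seq c.2) ?fset_uniq//= eqxx big1 ?addr0// => m mc.
  by rewrite eq_sym (negPf mc).
rewrite big_seq big1// => m mA; case: eqP => // cm.
by rewrite cm mA in cA.
Qed.

(** The coefficient of a monomial is the sum of its coefficients in all packets.
    If A contains every exponent of the first N packets, then F and the partial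
    sum over A differ only by terms of later packets, which contribute at most
    the tail of the summable bounds. *)
Lemma summable_expansion_partial_sum F : summable_expansion F ->
  exists c : {ffun I -> nat} -> C, forall h, (forall e, `|h e| < 1) ->
    partial_sum (fun m : {ffun I -> nat} => c m * monomial h m) @ totally --> F h.
Proof.
move=> [f [b [W [fb bW fF]]]].
have [L LP] : {L : nat -> seq (C * {ffun I -> nat}) & forall k,
    (forall h, f k h = eval_terms (L k) h) /\ \sum_(c <- L k) cabs c.1 <= b k}.
  apply: (choice (P := fun k L => (forall h, f k h = eval_terms L h) /\
    \sum_(c <- L) cabs c.1 <= b k)) => k; exact: fb.
have b0 k : 0 <= b k by exact: poly_le_bound_ge0 (fb k).
have ndb : {homo series b : p q / (p <= q)%N >-> p <= q}.
  by apply/nondecreasing_seqP => p; rewrite /series /= big_nat_recr//= lerDl.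
have cvb : cvgn (series b).
  apply: nondecreasing_is_cvgn => //; exists W => _ [N _ <-].
  by rewrite /series /= big_mkord.
pose coef k m : C := \sum_(c <- L k | c.2 == m) c.1.
have coefb k m : `|coef k m| <= (b k)%:C%C.
  apply: le_trans (ler_norm_sum _ _ _) _.
  have := (LP k).2; rewrite -lecR rmorph_sum; apply: le_trans.
  rewrite big_mkcond /=; apply: ler_sum => c _.
  by rewrite cabsE; case: ifP.
pose c m : C := lim ((series (coef ^~ m) : nat -> C) @ \oo).
have cvc m : (series (coef ^~ m) : nat -> C) @ \oo --> c m.
  by apply: is_cvg_complex_series cvb => k; exact: coefb.
have tot_filter : ProperFilter (@totally {ffun I -> nat}) by exact: totally_filter.
exists c => h h1; apply/cvgrPdist_le => /= e e0.
have er : (complex.Re e)%:C%C = e by rewrite RRe_real// gtr0_real.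
have re0 : 0 < complex.Re e by rewrite -ltcR er.
have [N tailN] : exists N, limn (series b) - series b N <= complex.Re e.
  have /cvgrPdist_le/(_ _ re0)[N _ NP] : series b @ \oo --> limn (series b) by [].
  by exists N; rewrite (le_trans _ (NP N _))//= ler_norm.
(* all the exponents of the first N packets *)
pose A0 : {fset {ffun I -> nat}} :=
  [fset m in flatten [seq [seq c.2 | c <- L k] | k <- iota 0 N]]%fset.
exists A0 => // A /= A0A.
have -> : partial_sum (fun m => c m * monomial h m) A =
    \sum_(m <- A) c m * monomial h m.
  by rewrite /partial_sum (big_seq_fsetE _ _ xpredT (fun m => c m * monomial h m)).
rewrite -er; pose E M := \sum_(k < M) (f k h - \sum_(m <- A) coef k m * monomial h m).
apply: (@norm_lim_le _ E).
  have -> : E = (fun M => \sum_(k < M) f k h) -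
      (fun M => \sum_(m <- A) series (coef ^~ m) M * monomial h m).
    apply/funext => M; transitivity (\sum_(k < M) f k h -
      \sum_(m <- A) series (coef ^~ m) M * monomial h m) => //.
    rewrite /E sumrB; congr (_ - _).
    rewrite exchange_big /=; apply: eq_bigr => m _.
    by rewrite /series /= big_mkord mulr_suml.
  apply: cvgB; first exact: fF.
  have -> : (fun M => \sum_(m <- A) series (coef ^~ m) M * monomial h m) =
     \sum_(m <- A) (fun M => series (coef ^~ m) M * monomial h m).
    by apply/funext => M; rewrite fct_sumE.
  elim/big_ind2 : _ => [|u x v y ux vy|m _]; [exact: cvg_cst|exact: cvgD|].
  by apply: cvgM; [exact: cvc|exact: cvg_cst].
exists N => // M /= NM.
have termE k : f k h - \sum_(m <- A) coef k m * monomial h m =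
    \sum_(d <- L k | d.2 \notin A) d.1 * monomial h d.2.
  rewrite (LP k).1 regroup_terms /eval_terms (bigID (fun d => d.2 \in A)) /=.
  by rewrite addrAC subrr add0r.
have term0 k : (k < N)%N -> f k h - \sum_(m <- A) coef k m * monomial h m = 0.
  move=> kN; rewrite termE big_seq_cond big1// => d /andP[dL].
  suff -> : d.2 \in A by [].
  apply: (fsubsetP A0A); rewrite in_fset; apply/flattenP.
  exists [seq c.2 | c <- L k]; last by apply/mapP; exists d.
  by apply/mapP; exists k => //; rewrite mem_iota.
have termb k : `|f k h - \sum_(m <- A) coef k m * monomial h m| <= (b k)%:C%C.
  rewrite termE; apply: le_trans (ler_norm_sum _ _ _) _.
  have := (LP k).2; rewrite -lecR rmorph_sum; apply: le_trans.
  rewrite big_mkcond /=; apply: ler_sum => d _.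
  rewrite cabsE; case: ifP => // _; rewrite normrM ler_piMr//.
  exact: norm_monomial_le.
rewrite /E -(big_mkord xpredT
  (fun k => f k h - \sum_(m <- A) coef k m * monomial h m)).
rewrite (big_cat_nat _ NM)//= big_nat big1 => [|k /andP[_ kN]]; last exact: term0.
rewrite add0r; apply: le_trans (ler_norm_sum _ _ _) _.
apply: (@le_trans _ _ (\sum_(N <= k < M) b k)%:C%C).
  by rewrite rmorph_sum; apply: ler_sum => k _; exact: termb.
rewrite lecR; apply: le_trans tailN.
have -> : \sum_(N <= k < M) b k = series b M - series b N.
  by rewrite /series /= [in RHS](big_cat_nat _ NM)//= addrAC subrr add0r.
by rewrite lerB// nondecreasing_cvgn_le.
Qed.

End PowerSeries.

(** * Polynomial matrices and products of their exponentials *)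

Section PolynomialMatrices.
Variable R : realType.
Local Notation C := (R[i] : numFieldType).
Variable I : finType.
Implicit Types (F G : {ffun I -> C} -> C).

Definition poly_bounded F : Prop := exists B : R, poly_le F B.

Lemma poly_bounded_cst (c : C) : poly_bounded (fun=> c).
Proof. by exists (cabs c); exact: poly_le_cst. Qed.

Lemma poly_bounded_coord e : poly_bounded (fun h => h e).
Proof. by exists 1; exact: poly_le_coord. Qed.

Lemma poly_boundedD F G : poly_bounded F -> poly_bounded G ->
  poly_bounded (fun h => F h + G h).
Proof. by move=> [B FB] [D GD]; exists (B + D); exact: poly_leD. Qed.

Lemma poly_boundedM F G : poly_bounded F -> poly_bounded G ->
  poly_bounded (fun h => F h * G h).
Proof. by move=> [B FB] [D GD]; exists (B * D); exact: poly_leM. Qed.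

Lemma poly_bounded_sum (K : Type) (r : seq K) (P : pred K) (F : K -> {ffun I -> C} -> C) :
  (forall i, poly_bounded (F i)) -> poly_bounded (fun h => \sum_(i <- r | P i) F i h).
Proof.
move=> FP; elim: r => [|i r IH].
  under eq_fun do rewrite big_nil; exact: poly_bounded_cst.
under eq_fun do rewrite big_cons.
by case: (P i) => //; exact: poly_boundedD.
Qed.

Lemma poly_bounded_prod (K : Type) (r : seq K) (P : pred K) (F : K -> {ffun I -> C} -> C) :
  (forall i, poly_bounded (F i)) -> poly_bounded (fun h => \prod_(i <- r | P i) F i h).
Proof.
move=> FP; elim: r => [|i r IH].
  under eq_fun do rewrite big_nil; exact: poly_bounded_cst.
under eq_fun do rewrite big_cons.
by case: (P i) => //; exact: poly_boundedM.
Qed.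

Definition poly_mx m n (W : {ffun I -> C} -> 'M[C]_(m, n)) : Prop :=
  forall a b, poly_bounded (fun h => W h a b).

Lemma poly_mx_cst m n (A : 'M[C]_(m, n)) : poly_mx (fun=> A).
Proof. by move=> a b; exact: poly_bounded_cst. Qed.

Lemma poly_mxM m n p (U : {ffun I -> C} -> 'M[C]_(m, n)) (W : _ -> 'M[C]_(n, p)) :
  poly_mx U -> poly_mx W -> poly_mx (fun h => U h *m W h).
Proof.
move=> UP WP a b; under eq_fun do rewrite mxE.
by apply: poly_bounded_sum => j; exact: poly_boundedM.
Qed.

Lemma poly_mxZ m n F (W : {ffun I -> C} -> 'M[C]_(m, n)) :
  poly_bounded F -> poly_mx W -> poly_mx (fun h => F h *: W h).
Proof.
move=> FP WP a b; under eq_fun do rewrite mxE.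
exact: poly_boundedM.
Qed.

Lemma poly_mxB m n (U W : {ffun I -> C} -> 'M[C]_(m, n)) :
  poly_mx U -> poly_mx W -> poly_mx (fun h => U h - W h).
Proof.
move=> UP WP a b.
have -> : (fun h => (U h - W h) a b) = fun h => U h a b + -1 * W h a b.
  by apply/funext => h; rewrite !mxE mulN1r.
by apply: poly_boundedD => //; apply: poly_boundedM => //; exact: poly_bounded_cst.
Qed.

Lemma poly_mx_tr m n (W : {ffun I -> C} -> 'M[C]_(m, n)) :
  poly_mx W -> poly_mx (fun h => (W h)^T).
Proof. by move=> WP a b; under eq_fun do rewrite mxE. Qed.

Lemma poly_mxX n (W : {ffun I -> C} -> 'M[C]_n) j :
  poly_mx W -> poly_mx (fun h => W h ^+ j).
Proof.
move=> WP; elim: j => [|j IH].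
  by under eq_fun do rewrite expr0; exact: poly_mx_cst.
by under eq_fun do rewrite exprS; exact: poly_mxM.
Qed.

Lemma poly_mx_sum (K : Type) (r : seq K) (P : pred K) m n
    (W : K -> {ffun I -> C} -> 'M[C]_(m, n)) :
  (forall i, poly_mx (W i)) -> poly_mx (fun h => \sum_(i <- r | P i) W i h).
Proof.
move=> WP a b; under eq_fun do rewrite summxE.
by apply: poly_bounded_sum => i; exact: WP.
Qed.

Lemma poly_mx_pf_gradient n (W : {ffun I -> C} -> 'M[C]_n) :
  poly_mx W -> poly_mx (fun h => pf_gradient (W h)).
Proof.
move=> WP; suff DP : poly_mx (fun h => pf_partials (W h)).
  apply: poly_mxZ; first exact: poly_bounded_cst.
  by apply: poly_mxB => //; exact: poly_mx_tr.
apply: poly_mxZ; first exact: poly_bounded_cst.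
apply: poly_mx_sum => s; apply: poly_mxZ; first exact: poly_bounded_cst.
apply: poly_mx_sum => l; apply: poly_mxZ; last exact: poly_mx_cst.
by apply: poly_bounded_prod => j; exact: WP.
Qed.

Lemma poly_mx_inv_gradient k i j (W : {ffun I -> C} -> 'M[C]_i) :
  poly_mx W -> poly_mx (fun h => inv_gradient k j (W h)).
Proof.
move=> WP; case: k => /=.
  by apply: poly_mxZ; [exact: poly_bounded_cst|exact: poly_mxX].
case: (~~ odd i && _); first exact: poly_mx_pf_gradient.
by apply: poly_mxZ; [exact: poly_bounded_cst|exact: poly_mxX].
Qed.

Lemma poly_mx_gz_gradient k n (p : gz_index k n) (W : {ffun I -> C} -> 'M[C]_n) :
  poly_mx W -> poly_mx (fun h => gz_gradient p (W h)).
Proof.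
move=> WP; rewrite /gz_gradient.
apply: poly_mxM; last exact: poly_mx_cst.
apply: poly_mxM; first exact: poly_mx_cst.
apply: poly_mx_inv_gradient => a b.
have -> : (fun h => cutoff (level_leq (tag p)) (W h) a b) =
    fun h => W h (widen_ord (level_leq (tag p)) a) (widen_ord (level_leq (tag p)) b).
  by apply/funext => h; rewrite mxE.
exact: WP.
Qed.

Definition summable_mx m n (W : {ffun I -> C} -> 'M[C]_(m, n)) : Prop :=
  forall a b, summable_expansion (fun h => W h a b).

Lemma poly_summable_mx m n (W : {ffun I -> C} -> 'M[C]_(m, n)) :
  poly_mx W -> summable_mx W.
Proof. by move=> WP a b; have [B] := WP a b; exact: summable_poly. Qed.

Lemma summable_mxM m n p (U : {ffun I -> C} -> 'M[C]_(m, n)) (W : _ -> 'M[C]_(n, p)) :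
  summable_mx U -> summable_mx W -> summable_mx (fun h => U h *m W h).
Proof.
move=> US WS a b; under eq_fun do rewrite mxE.
elim: (index_enum _) => [|j r IH].
  by under eq_fun do rewrite big_nil; apply: summable_poly (poly_le_cst _ _).
under eq_fun do rewrite big_cons.
exact: summableD (summableM (US a j) (WS j b)) IH.
Qed.

Lemma summable_mx_exp_conj n (w W : {ffun I -> C} -> 'M[C]_n) :
  poly_mx w -> summable_mx W -> summable_mx (fun h => exp_conj (w h) (W h)).
Proof.
move=> wP WS; apply: summable_mxM; last first.
  move=> a b; apply: summable_expm => i j.
  have [|B wB] := @poly_mxZ _ _ (fun=> -1) w _ wP i j; first exact: poly_bounded_cst.
  by exists B; under eq_fun do rewrite -scaleN1r.
by apply: summable_mxM WS => a b; exact: summable_expm wP.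
Qed.

End PolynomialMatrices.

(** * The action *)

Section GelfandZeitlinAction.
Variable R : realType.
Local Notation C := (R[i] : numFieldType).
Variables (k : lie_type) (n : nat).
Local Notation T := (gz_index k n).
Implicit Types (t : {ffun T -> C}) (x y : 'M[C]_n) (l : seq T) (p q : T).

Definition compose_flows l t x : 'M[C]_n :=
  foldr (fun p y => gz_flow p (t p) y) x l.

Lemma compose_flows_in l t x : x \in lie_alg C k n ->
  compose_flows l t x \in lie_alg C k n.
Proof. by move=> x_in; elim: l => [//|p l IH] /=; exact: gz_flow_in. Qed.

Lemma compose_flows0 l x : compose_flows l 0 x = x.
Proof. by elim: l => [//|p l IH] /=; rewrite IH ffunE gz_flow0. Qed.

Lemma gz_flow_compose_flows l p s t x : x \in lie_alg C k n ->
  gz_flow p s (compose_flows l t x) = compose_flows l t (gz_flow p s x).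
Proof.
move=> x_in; elim: l => [//|q l IH] /=.
by rewrite (gz_flowC _ _ _ _ (compose_flows_in l t x_in)) IH.
Qed.

Lemma compose_flowsD l s t x : x \in lie_alg C k n ->
  compose_flows l (s + t) x = compose_flows l s (compose_flows l t x).
Proof.
move=> x_in; elim: l => [//|p l IH] /=.
have lt_in := compose_flows_in l t x_in.
rewrite ffunE IH gz_flowD; last exact: compose_flows_in.
by rewrite -(gz_flow_compose_flows _ _ _ _ lt_in).
Qed.

Lemma compose_flows_notin l p (s : C) x : p \notin l ->
  compose_flows l (coord_subgroup p s) x = x.
Proof.
elim: l => [//|q l IH] /=; rewrite inE negb_or eq_sym => /andP[/negPf qp pl].
by rewrite ffunE qp IH// gz_flow0.
Qed.

Lemma compose_flows_coord l p (s : C) x : uniq l -> p \in l ->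
  compose_flows l (coord_subgroup p s) x = gz_flow p s x.
Proof.
elim: l => [//|q l IH] /= /andP[ql ul]; rewrite inE ffunE eq_sym.
case: eqP => [<- _|_ /= pl]; first by rewrite compose_flows_notin.
by rewrite gz_flow0 IH.
Qed.

Lemma gz_gradient_compose_flows p l t x : x \in lie_alg C k n ->
  all (fun q => (level p <= level q)%N) l ->
  gz_gradient p (compose_flows l t x) = gz_gradient p x.
Proof.
move=> x_in; elim: l => [//|q l IH] /= /andP[pq pl].
rewrite (gz_gradient_flow_below _ pq (compose_flows_in l t x_in)).
exact: IH.
Qed.

(** The variant of [compose_flows] in which every gradient is evaluated at the
    starting point. *)
Definition compose_exp_conj l t x : 'M[C]_n :=
  foldr (fun p y => exp_conj (- t p *: gz_gradient p x) y) x l.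

(** The last flows of the list are applied first and have the highest levels,
    so they preserve the gradients that come before them in the list. *)
Lemma compose_flows_closed_form l t x : x \in lie_alg C k n ->
  sorted (fun p q : T => (level p <= level q)%N) l ->
  compose_flows l t x = compose_exp_conj l t x.
Proof.
move=> x_in; rewrite sorted_pairwise; last by move=> p q r; exact: leq_trans.
elim: l => [//|p l IH] /= /andP[pl /IH lE].
by rewrite [LHS]gz_flowE (gz_gradient_compose_flows _ x_in pl) lE.
Qed.

Definition gz_order : seq T :=
  sort (fun p q => (level p <= level q)%N) (enum T).

Definition gz_act t x : 'M[C]_n := compose_flows gz_order t x.

Lemma gz_act_additive : is_additive_action k gz_act.
Proof.
split=> [t x x_in|x x_in|s t x x_in].
- exact: compose_flows_in.
- exact: compose_flows0.
- exact: compose_flowsD.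
Qed.

Lemma gz_act_flows : acts_by_flows k gz_act (@gz_field C k n).
Proof.
move=> p x x_in s.
have coordE s' : gz_act (coord_subgroup p s') x = gz_flow p s' x.
  by apply: compose_flows_coord; rewrite ?sort_uniq ?enum_uniq// mem_sort mem_enum.
rewrite coordE; under eq_fun do rewrite coordE.
exact: is_derive_gz_flow.
Qed.

Lemma compose_exp_conj_summable l (a : {ffun T + 'I_n * 'I_n -> C}) :
  summable_mx (fun h : {ffun T + 'I_n * 'I_n -> C} =>
    compose_exp_conj l (group_part (a + h)) (matrix_part (a + h))).
Proof.
have coordP e : poly_bounded (fun h : {ffun T + 'I_n * 'I_n -> C} => (a + h) e).
  under eq_fun do rewrite ffunE.
  by apply: poly_boundedD; [exact: poly_bounded_cst|exact: poly_bounded_coord].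
have matrixP : poly_mx (fun h : {ffun T + 'I_n * 'I_n -> C} => matrix_part (a + h)).
  by move=> i j; under eq_fun do rewrite mxE; exact: coordP.
elim: l => [|p l IH]; first exact: poly_summable_mx.
apply: summable_mx_exp_conj IH.
apply: poly_mxZ; last exact: poly_mx_gz_gradient.
under eq_fun do rewrite ffunE -mulN1r.
by apply: poly_boundedM; [exact: poly_bounded_cst|exact: coordP].
Qed.

Lemma gz_act_analytic : analytic_action k gz_act.
Proof.
move=> i j a _.
have [c cP] := summable_expansion_partial_sum (compose_exp_conj_summable gz_order a i j).
exists c, 1; split => // h h1 ah_in.
have order_sorted : sorted (fun p q : T => (level p <= level q)%N) gz_order.
  by apply: sort_sorted => p q; exact: leq_total.
rewrite /gz_act (compose_flows_closed_form _ ah_in order_sorted).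
exact: cP.
Qed.

End GelfandZeitlinAction.

Theorem theorem1p2 (R : realType) (k : lie_type) (n : nat) (n_gt0 : (0 < n)%N)
    (x0 : 'M[R[i]]_n) (x0_in : x0 \in lie_alg R[i] k n) (x0_reg : regular k x0)
    (d : nat) (d_half : orbit_dim k x0 = d.*2) :
  #|gz_index k n| = d /\
  exists act : {ffun gz_index k n -> R[i]} -> 'M[R[i]]_n -> 'M[R[i]]_n,
    [/\ is_additive_action k act,
        analytic_action k act
      & acts_by_flows k act (@gz_field R[i] k n)].
Proof.
split; first exact: card_gz_index_half_orbit n_gt0 x0_reg d_half.
exists (@gz_act R k n); split.
- exact: gz_act_additive.
- exact: gz_act_analytic.
- exact: gz_act_flows.
Qed.
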